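(* In the setup below, with the $a_i,b_i,c_{i,j}$ fixed, $$\lim_{t\to0}\frac{\det\bigl(\langle\gamma_{s,t},\alpha_j\rangle\bigr)_{s\in S,\,1\le j\le g}}{\log^g|t|}=\pm1,$$ where $\alpha_1,\dots,\alpha_g$ are the elements $R(1;1,j|2;1,m)$ ($1<j\le N_1$, $1<m\le N_2$), $T(1,1|k,l|m,n)$ ($2\le k<m\le N$, $1\le l\le N_k$, $1\le n\le N_m$), $T(1,j|2,1|m,n)$ ($2\le j\le N_1$, $3\le m\le N$, $1\le n\le N_m$) of $K_2^T(X_t)$.
   Context: Let $N\ge2$, $N_i\ge1$, and $L_{i,j}=a_ix+b_iy+c_{i,j}$ ($1\le i\le N$, $1\le j\le N_i$) complex non-constant polynomials defining pairwise distinct lines, with $[i,k]:=a_ib_k-a_kb_i\ne0$ for $i\ne k$; assume no three of the lines $L_{i,j}=0$ meet in an affine point. For $t\in\mathbb C$ let $X_t$ be the normalisation of the projective closure of $\prod_{i,j}L_{i,j}=t$; for $t\ne0$ small it is a smooth compact Riemann surface of genus $g=\sum_{i<k}N_iN_k-\sum_iN_i+1$. In its function field, $R(i;j,k|l;m,n)=\{L_{i,j}/L_{i,k},L_{l,m}/L_{l,n}\}$ ($i\ne l$) and $T(i,j|k,l|m,n)=\bigl\{\frac{[i,m]}{[k,m]}\frac{L_{k,l}}{L_{i,j}},\frac{[i,k]}{[m,k]}\frac{L_{m,n}}{L_{i,j}}\bigr\}$ ($i,k,m$ distinct) are elements of $K_2^T(X_t)$ (kernel of all tame symbols). Regulator pairing: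 $\langle\gamma,\alpha\rangle=\frac1{2\pi}\int_\gamma\eta(\alpha)$, where $\eta$ is extended additively from $\eta(\{a,b\})=\log|a|\,d\arg b-\log|b|\,d\arg a$, for loops $\gamma$ avoiding zeroes and poles. Let $P_{i,j;k,l}$ be the intersection point of $L_{i,j}=0$ and $L_{k,l}=0$, $S=\{P_{i,j;k,l}:1\le i<k\le N,(i,j)\ne(1,1),(i,k,l)\ne(1,2,1)\}$ ($g$ elements). Loops: choose coordinates such that $x$-projection of $X_0$ is unramified away from intersection points and distinct intersection points have distinct $x$-coordinates; for $s$ an intersection point, a line $L$ through $s$ and a small circle $\gamma'$ around the $x$-coordinate of $s$, $\gamma_{s,0}$ is the lift of $\gamma'$ into $L$ and $\gamma_{s,t}\subset X_t$ is its continuous deformation lifting $\gamma'$ for small $t$ (a closed loop near $s$). *)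

(* Defs.v *)
From Stdlib Require Import Reals Lra List Arith Bool ClassicalEpsilon.
Import ListNotations.
Open Scope R_scope.

Definition CC : Type := (R * R)%type.
Definition Cre (z : CC) : R := fst z.
Definition Cim (z : CC) : R := snd z.
Definition RtoC (x : R) : CC := (x, 0).
Definition C0 : CC := (0, 0).
Definition C1 : CC := (1, 0).
Definition Cadd (z w : CC) : CC := (fst z + fst w, snd z + snd w).
Definition Copp (z : CC) : CC := (- fst z, - snd z).
Definition Csub (z w : CC) : CC := Cadd z (Copp w).
Definition Cmul (z w : CC) : CC :=
  (fst z * fst w - snd z * snd w, fst z * snd w + snd z * fst w).
Definition Cinv (z : CC) : CC :=
  (fst z / (fst z ^ 2 + snd z ^ 2), - snd z / (fst z ^ 2 + snd z ^ 2)).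
Definition Cdiv (z w : CC) : CC := Cmul z (Cinv w).
Definition Cnorm (z : CC) : R := sqrt (fst z ^ 2 + snd z ^ 2).
Definition Cexpi (th : R) : CC := (cos th, sin th).

Fixpoint sumR (n : nat) (f : nat -> R) : R :=
  match n with O => 0 | S m => sumR m f + f m end.

Definition minor (M : nat -> nat -> R) (j : nat) : nat -> nat -> R :=
  fun r c => M (S r) (if Nat.ltb c j then c else S c).

Fixpoint det (n : nat) (M : nat -> nat -> R) : R :=
  match n with
  | O => 1
  | S m => sumR (S m) (fun j => (-1) ^ j * M O j * det m (minor M j))
  end.

Definition RInt (f : R -> R) (lo hi : R) : R :=
  match excluded_middle_informative (inhabited (Riemann_integrable f lo hi)) with
  | left H => RiemannInt (epsilon H (fun _ => True))
  | right _ => 0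
  end.

(* Indices are 1-based as in the paper: 1 <= i <= N, 1 <= j <= Ns i.
   L_{i,j}(x,y) = a i * x + b i * y + c i j. *)
Definition Lval (a b : nat -> CC) (c : nat -> nat -> CC) (i j : nat) (P : CC * CC) : CC :=
  Cadd (Cadd (Cmul (a i) (fst P)) (Cmul (b i) (snd P))) (c i j).

Definition bracket (a b : nat -> CC) (i k : nat) : CC :=
  Csub (Cmul (a i) (b k)) (Cmul (a k) (b i)).

Definition range1 (n : nat) : list nat := seq 1 n.

Definition line_indices (N : nat) (Ns : nat -> nat) : list (nat * nat) :=
  flat_map (fun i => map (fun j => (i, j)) (range1 (Ns i))) (range1 N).

Definition valid_line (N : nat) (Ns : nat -> nat) (p : nat * nat) : Prop :=
  (1 <= fst p <= N)%nat /\ (1 <= snd p <= Ns (fst p))%nat.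

Definition Fpoly (N : nat) (Ns : nat -> nat) (a b : nat -> CC) (c : nat -> nat -> CC)
  (P : CC * CC) : CC :=
  fold_right (fun p acc => Cmul (Lval a b c (fst p) (snd p) P) acc) C1
    (line_indices N Ns).

(* intersection point P_{i,j;k,l} of L_{i,j}=0 and L_{k,l}=0 (i<>k), by Cramer *)
Definition Px (a b : nat -> CC) (c : nat -> nat -> CC) (i j k l : nat) : CC :=
  Cdiv (Cadd (Copp (Cmul (c i j) (b k))) (Cmul (c k l) (b i))) (bracket a b i k).
Definition Py (a b : nat -> CC) (c : nat -> nat -> CC) (i j k l : nat) : CC :=
  Cdiv (Cadd (Copp (Cmul (a i) (c k l))) (Cmul (a k) (c i j))) (bracket a b i k).

(* quadruples (i,j,k,l) : intersection points P_{i,j;k,l} with i<k *)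
Definition quad : Type := (nat * nat * nat * nat)%type.

Definition all_quads (N : nat) (Ns : nat -> nat) : list quad :=
  flat_map (fun i =>
  flat_map (fun k =>
  flat_map (fun j =>
  map (fun l => (i, j, k, l)) (range1 (Ns k)))
  (range1 (Ns i)))
  (seq (S i) (N - i)))
  (range1 N).

(* S = {P_{i,j;k,l} : i<k, (i,j)<>(1,1), (i,k,l)<>(1,2,1)}, listed by indices
   (distinct quadruples give distinct points since no three lines meet) *)
Definition S_list (N : nat) (Ns : nat -> nat) : list quad :=
  filter (fun q => match q with (i, j, k, l) =>
            negb (Nat.eqb i 1 && Nat.eqb j 1) &&
            negb (Nat.eqb i 1 && Nat.eqb k 2 && Nat.eqb l 1) end)
    (all_quads N Ns).

(* ---------- elements of K_2 (single Steinberg symbols) ---------- *)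
(* A "component" const * L_num / L_den, stored as (const, num index, den index). *)
Definition comp : Type := (CC * (nat * nat) * (nat * nat))%type.
Definition symb : Type := (comp * comp)%type.

Definition Rsym (i j k l m n : nat) : symb :=
  ((C1, (i, j), (i, k)), (C1, (l, m), (l, n))).

Definition Tsym (a b : nat -> CC) (i j k l m n : nat) : symb :=
  ((Cdiv (bracket a b i m) (bracket a b k m), (k, l), (i, j)),
   (Cdiv (bracket a b i k) (bracket a b m k), (m, n), (i, j))).

Definition alpha_list (N : nat) (Ns : nat -> nat) (a b : nat -> CC) : list symb :=
  flat_map (fun j => map (fun m => Rsym 1 1 j 2 1 m) (seq 2 (Ns 2%nat - 1)))
    (seq 2 (Ns 1%nat - 1))
  ++
  flat_map (fun k =>
  flat_map (fun m =>
  flat_map (fun l =>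
  map (fun n => Tsym a b 1 1 k l m n) (range1 (Ns m)))
  (range1 (Ns k)))
  (seq (S k) (N - k)))
  (seq 2 (N - 1))
  ++
  flat_map (fun j =>
  flat_map (fun m =>
  map (fun n => Tsym a b 1 j 2 1 m n) (range1 (Ns m)))
  (seq 3 (N - 2)))
  (seq 2 (Ns 1%nat - 1)).

Definition comp_logabs (a b : nat -> CC) (c : nat -> nat -> CC) (A : comp)
  (P : CC * CC) : R :=
  match A with (k, (p1, p2), (q1, q2)) =>
    ln (Cnorm k) + ln (Cnorm (Lval a b c p1 p2 P)) - ln (Cnorm (Lval a b c q1 q2 P))
  end.

Definition Lder (a b : nat -> CC) (p1 : nat) (DP : CC * CC) : CC :=
  Cadd (Cmul (a p1) (fst DP)) (Cmul (b p1) (snd DP)).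

(* (d arg A)/dtheta = Im((A o gamma)'/(A o gamma)) *)
Definition comp_darg (a b : nat -> CC) (c : nat -> nat -> CC) (A : comp)
  (P DP : CC * CC) : R :=
  match A with (k, (p1, p2), (q1, q2)) =>
    Cim (Cdiv (Lder a b p1 DP) (Lval a b c p1 p2 P))
    - Cim (Cdiv (Lder a b q1 DP) (Lval a b c q1 q2 P))
  end.

Definition eta_pullback (a b : nat -> CC) (c : nat -> nat -> CC) (al : symb)
  (P DP : CC * CC) : R :=
  comp_logabs a b c (fst al) P * comp_darg a b c (snd al) P DP
  - comp_logabs a b c (snd al) P * comp_darg a b c (fst al) P DP.

Definition pairing (a b : nat -> CC) (c : nat -> nat -> CC)
  (gam dgam : R -> CC * CC) (al : symb) : R :=
  / (2 * PI) * RInt (fun th => eta_pullback a b c al (gam th) (dgam th)) 0 (2 * PI).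

Definition quad_x (a b : nat -> CC) (c : nat -> nat -> CC) (s : quad) : CC :=
  match s with (i, j, k, l) => Px a b c i j k l end.

Definition circ_x (a b : nat -> CC) (c : nat -> nat -> CC) (r : R) (s : quad) (th : R) : CC :=
  Cadd (quad_x a b c s) (Cmul (RtoC r) (Cexpi th)).
Definition circ_dx (r : R) (th : R) : CC := Cmul (RtoC r) (- sin th, cos th).

Definition chosen_line (ch : quad -> bool) (s : quad) : nat * nat :=
  match s with (i, j, k, l) => if ch s then (i, j) else (k, l) end.

Definition lift_y (a b : nat -> CC) (c : nat -> nat -> CC) (p : nat * nat) (x : CC) : CC :=
  Copp (Cdiv (Cadd (Cmul (a (fst p)) x) (c (fst p) (snd p))) (b (fst p))).

Definition reg_matrix (N : nat) (Ns : nat -> nat) (a b : nat -> CC) (c : nat -> nat -> CC)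
  (r : R) (Y DY : quad -> CC -> R -> CC) (t : CC) : nat -> nat -> R :=
  fun u v =>
    let s := nth u (S_list N Ns) ((0, 0, 0, 0))%nat in
    let al := nth v (alpha_list N Ns a b) ((C1, (0, 0), (0, 0)), (C1, (0, 0), (0, 0)))%nat in
    pairing a b c (fun th => (circ_x a b c r s th, Y s t th))
                  (fun th => (circ_dx r th, DY s t th)) al.

Definition genus (N : nat) (Ns : nat -> nat) : nat :=
  (fold_right plus 0%nat
     (flat_map (fun i => map (fun k => Ns i * Ns k)%nat (seq (S i) (N - i))) (range1 N))
   + 1 - fold_right plus 0%nat (map Ns (range1 N)))%nat.

(* Main.v *)
(** Near a node [s], let [p] be the chosen line and [q0] the other line through [s].
    On the loop all [L_q] with [q <> p] stay away from [0] and converge uniformly, while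
    [u = L_p = t / prod_{q <> p} L_q] tends to [0] with [log |u| / log |t| -> 1].
    The logarithmic derivatives [L_q' / L_q] converge uniformly as well: to those of the
    restrictions of [L_q] to the line [p] if [q <> p], and to minus their sum if [q = p].
    Hence the pairing with [{A, B}], divided by [log |t|], tends to
    [ord_p A * ord_q0 B - ord_q0 A * ord_p B], because the winding number of [L_q] along
    the lifted circle is [1] if [q = q0] and [0] if [q <> p, q0]. The resulting integer
    matrix becomes triangular with diagonal entries [1] and [-1] once the nodes are matched
    with the symbols, and its determinant is found by Laplace expansion along the rows. *)

From Stdlib Require Import Reals Lra Lia List Arith Permutation ClassicalEpsilon.
From Coquelicot Require Import Coquelicot.
Require Import Defs.
Import ListNotations.
Open Scope R_scope.

(** * Uniform limits on the loop as [t] tends to 0 *)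

(** The obstacle is that only the loop itself is assumed to converge, not its derivative [DY], while
    the pairing integrates [d arg]. Convergence of the derivative has to be extracted from the
    curve: differentiating [u * prod L = t] along the loop gives a linear equation for [u' / u]
    whose leading coefficient tends to 1, so [u' / u] has a limit and [u' = u * (u' / u)] tends to
    0. A second point is that the integral of the statement is total, with value 0 on functions that
    are not integrable. Continuity for small [t] is therefore part of the notion of limit used
    throughout. Finally, the winding numbers are right only if the circle separates the node from
    the zeros of all other lines on the chosen line, and one radius must serve all nodes and all
    choices of line. The sign of the determinant remains open because a choice of line can change
    the sign of a row and because the matching of rows with columns is an arbitrary permutation. *)

Definition for_small_t (P : C -> R -> Prop) : Prop :=
  exists del, 0 < del /\
    forall t, 0 < Cmod t < del -> forall th, 0 <= th <= 2 * PI -> P t th.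

Lemma for_small_t_and (P Q : C -> R -> Prop) :
  for_small_t P -> for_small_t Q -> for_small_t (fun t th => P t th /\ Q t th).
Proof.
  intros [d1 [Hd1 H1]] [d2 [Hd2 H2]].
  exists (Rmin d1 d2); split; [now apply Rmin_pos|].
  intros t Ht th Hth.
  pose proof (Rmin_l d1 d2). pose proof (Rmin_r d1 d2).
  split; [apply H1 | apply H2]; lra.
Qed.

Lemma for_small_t_imp (P Q : C -> R -> Prop) :
  (forall t th, 0 < Cmod t -> 0 <= th <= 2 * PI -> P t th -> Q t th) ->
  for_small_t P -> for_small_t Q.
Proof.
  intros HPQ [d [Hd H]]. exists d; split; [exact Hd|].
  intros t Ht th Hth. apply HPQ; [lra | lra | now apply H].
Qed.

Lemma for_small_t_always (P : C -> R -> Prop) : (forall t th, P t th) -> for_small_t P.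
Proof. intros H. exists 1. split; [lra|]. intros; apply H. Qed.

Lemma for_small_t_list {A : Type} (l : list A) (P : A -> C -> R -> Prop) :
  (forall x, In x l -> for_small_t (P x)) ->
  for_small_t (fun t th => forall x, In x l -> P x t th).
Proof.
  induction l as [|y l IH]; intros H.
  - exists 1; split; [lra|]. intros t _ th _ x [].
  - assert (H1 : for_small_t (P y)) by (apply H; now left).
    assert (H2 : for_small_t (fun t th => forall x, In x l -> P x t th))
      by (apply IH; intros x Hx; apply H; now right).
    apply for_small_t_imp with (2 := for_small_t_and _ _ H1 H2).
    intros t th _ _ [K1 K2] x [<-|Hx]; [exact K1 | now apply K2].
Qed.

(* Continuity is only known on [[0, 2 PI]]; the extension [g] avoids one-sided
   continuity at the end points. *)
Definition cont_on_circle (f : R -> C) : Prop :=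
  exists g : R -> C,
    forall th, 0 <= th <= 2 * PI ->
      g th = f th /\
      continuity_pt (fun x => Re (g x)) th /\ continuity_pt (fun x => Im (g x)) th.

Lemma cont_on_circle_ext (f f' : R -> C) :
  (forall th, 0 <= th <= 2 * PI -> f th = f' th) -> cont_on_circle f -> cont_on_circle f'.
Proof.
  intros E [g H]. exists g. intros th Hth. destruct (H th Hth) as [H1 H2].
  split; [rewrite H1; now apply E | exact H2].
Qed.

Lemma cont_on_circle_plus (f f' : R -> C) :
  cont_on_circle f -> cont_on_circle f' -> cont_on_circle (fun th => f th + f' th)%C.
Proof.
  intros [g H] [g' H']. exists (fun th => g th + g' th)%C. intros th Hth.
  destruct (H th Hth) as [<- [H2 H3]]. destruct (H' th Hth) as [<- [H2' H3']].
  split; [reflexivity|]. split.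
  - exact (continuity_pt_plus _ _ _ H2 H2').
  - exact (continuity_pt_plus _ _ _ H3 H3').
Qed.

Lemma cont_on_circle_mult (f f' : R -> C) :
  cont_on_circle f -> cont_on_circle f' -> cont_on_circle (fun th => f th * f' th)%C.
Proof.
  intros [g H] [g' H']. exists (fun th => g th * g' th)%C. intros th Hth.
  destruct (H th Hth) as [<- [H2 H3]]. destruct (H' th Hth) as [<- [H2' H3']].
  split; [reflexivity|]. split.
  - exact (continuity_pt_minus _ _ _ (continuity_pt_mult _ _ _ H2 H2')
             (continuity_pt_mult _ _ _ H3 H3')).
  - exact (continuity_pt_plus _ _ _ (continuity_pt_mult _ _ _ H2 H3')
             (continuity_pt_mult _ _ _ H3 H2')).
Qed.

Lemma sum_sqr_pos (z : C) : z <> 0%C -> 0 < fst z ^ 2 + snd z ^ 2.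
Proof.
  intros Hz. destruct z as [x y]; simpl.
  destruct (Req_dec x 0) as [->|Hx].
  - destruct (Req_dec y 0) as [->|Hy]; [now elim Hz | nra].
  - nra.
Qed.

Lemma continuity_pt_normsq (g : R -> C) (th : R) :
  continuity_pt (fun x => Re (g x)) th -> continuity_pt (fun x => Im (g x)) th ->
  continuity_pt (fun x => fst (g x) ^ 2 + snd (g x) ^ 2) th.
Proof.
  intros H1 H2.
  apply (continuity_pt_plus (fun x => fst (g x) ^ 2) (fun x => snd (g x) ^ 2)).
  - apply (continuity_pt_comp (fun x => fst (g x)) (fun x => x ^ 2)); [exact H1|].
    apply derivable_continuous_pt, derivable_pt_pow.
  - apply (continuity_pt_comp (fun x => snd (g x)) (fun x => x ^ 2)); [exact H2|].
    apply derivable_continuous_pt, derivable_pt_pow.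
Qed.

Lemma cont_on_circle_inv (f : R -> C) :
  cont_on_circle f -> (forall th, 0 <= th <= 2 * PI -> f th <> 0%C) ->
  cont_on_circle (fun th => / f th)%C.
Proof.
  intros [g H] Hnz. exists (fun th => / g th)%C. intros th Hth.
  destruct (H th Hth) as [E [H2 H3]]. rewrite <- E.
  assert (Hp : fst (g th) ^ 2 + snd (g th) ^ 2 <> 0).
  { apply Rgt_not_eq, sum_sqr_pos. rewrite E. now apply Hnz. }
  pose proof (continuity_pt_normsq g th H2 H3) as Hn.
  split; [reflexivity|]. split.
  - exact (continuity_pt_div _ _ _ H2 Hn Hp).
  - exact (continuity_pt_div _ _ _ (continuity_pt_opp _ _ H3) Hn Hp).
Qed.

Lemma cont_on_circle_real (f : R -> R) :
  (exists g : R -> R, forall th, 0 <= th <= 2 * PI -> g th = f th /\ continuity_pt g th) ->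
  cont_on_circle (fun th => Complex.RtoC (f th)).
Proof.
  intros [g H]. exists (fun th => Complex.RtoC (g th)). intros th Hth.
  destruct (H th Hth) as [<- H2]. split; [reflexivity|]. split; [exact H2|].
  apply continuity_pt_const. now intros x y.
Qed.

Lemma cont_on_circle_Im (f : R -> C) :
  cont_on_circle f -> cont_on_circle (fun th => Complex.RtoC (Im (f th))).
Proof.
  intros [g H]. apply cont_on_circle_real. exists (fun th => Im (g th)). intros th Hth.
  destruct (H th Hth) as [<- [_ H3]]. now split.
Qed.

Lemma cont_on_circle_ln_Cmod (f : R -> C) :
  cont_on_circle f -> (forall th, 0 <= th <= 2 * PI -> f th <> 0%C) ->
  cont_on_circle (fun th => Complex.RtoC (ln (Cmod (f th)))).
Proof.
  intros [g H] Hnz. apply cont_on_circle_real. exists (fun th => ln (Cmod (g th))).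
  intros th Hth. destruct (H th Hth) as [E [H2 H3]]. split; [now rewrite E|].
  assert (Hg : g th <> 0%C) by (rewrite E; now apply Hnz).
  apply (continuity_pt_comp (fun x => Cmod (g x)) ln).
  - apply (continuity_pt_comp (fun x => fst (g x) ^ 2 + snd (g x) ^ 2) sqrt).
    + now apply continuity_pt_normsq.
    + apply continuity_pt_sqrt, Rlt_le, sum_sqr_pos, Hg.
  - apply derivable_continuous_pt. exists (/ Cmod (g th)).
    apply derivable_pt_lim_ln. now apply Cmod_gt_0.
Qed.

Definition ulim (f : C -> R -> C) (g : R -> C) : Prop :=
  (exists M, forall th, 0 <= th <= 2 * PI -> Cmod (g th) <= M) /\
  (forall eps, 0 < eps -> for_small_t (fun t th => Cmod (f t th - g th) < eps)) /\
  for_small_t (fun t _ => cont_on_circle (f t)).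

Lemma ulim_ext (f f' : C -> R -> C) (g g' : R -> C) :
  for_small_t (fun t th => f t th = f' t th) ->
  (forall th, 0 <= th <= 2 * PI -> g th = g' th) ->
  ulim f g -> ulim f' g'.
Proof.
  intros Ef Eg [[M HM] [H1 H2]]. split; [|split].
  - exists M. intros th Hth. rewrite <- Eg by exact Hth. now apply HM.
  - intros eps Heps.
    apply for_small_t_imp with (2 := for_small_t_and _ _ Ef (H1 eps Heps)).
    intros t th _ Hth [E K]. now rewrite <- E, <- Eg.
  - destruct Ef as [d1 [Hd1 Ef]], H2 as [d2 [Hd2 H2]].
    exists (Rmin d1 d2); split; [now apply Rmin_pos|].
    pose proof (Rmin_l d1 d2). pose proof (Rmin_r d1 d2).
    intros t Ht th Hth. apply cont_on_circle_ext with (f t).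
    + intros x Hx. apply Ef; lra.
    + apply (H2 t) with th; lra.
Qed.

Lemma ulim_fixed (g : R -> C) (M : R) :
  (forall th, 0 <= th <= 2 * PI -> Cmod (g th) <= M) -> cont_on_circle g ->
  ulim (fun _ => g) g.
Proof.
  intros HM Hc. split; [now exists M|]. split.
  - intros eps Heps. exists 1; split; [lra|]. intros t _ th _.
    replace (g th - g th)%C with (Complex.RtoC 0) by ring. now rewrite Cmod_0.
  - exists 1; split; [lra|]. now intros.
Qed.

Lemma ulim_const (z : C) : ulim (fun _ _ => z) (fun _ => z).
Proof.
  apply (ulim_fixed (fun _ => z) (Cmod z)); [intros; lra|].
  exists (fun _ => z). intros th _. repeat split; apply continuity_pt_const; now intros x y.
Qed.

Lemma ulim_plus (f f' : C -> R -> C) (g g' : R -> C) :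
  ulim f g -> ulim f' g' ->
  ulim (fun t th => f t th + f' t th)%C (fun th => g th + g' th)%C.
Proof.
  intros [[M HM] [H1 H2]] [[M' HM'] [H1' H2']]. split; [|split].
  - exists (M + M'). intros th Hth. eapply Rle_trans; [apply Cmod_triangle|].
    now apply Rplus_le_compat; auto.
  - intros eps Heps.
    assert (He : 0 < eps / 2) by lra.
    apply for_small_t_imp with (2 := for_small_t_and _ _ (H1 _ He) (H1' _ He)).
    intros t th _ _ [K1 K2].
    replace (f t th + f' t th - (g th + g' th))%C
      with ((f t th - g th) + (f' t th - g' th))%C by ring.
    eapply Rle_lt_trans; [apply Cmod_triangle | lra].
  - apply for_small_t_imp with (2 := for_small_t_and _ _ H2 H2').
    intros t th _ _ [K1 K2]. now apply cont_on_circle_plus.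
Qed.

Lemma ulim_mult (f f' : C -> R -> C) (g g' : R -> C) :
  ulim f g -> ulim f' g' ->
  ulim (fun t th => f t th * f' t th)%C (fun th => g th * g' th)%C.
Proof.
  intros [[M0 HM0] [H1 H2]] [[M0' HM0'] [H1' H2']].
  assert (HM : forall th, 0 <= th <= 2 * PI -> Cmod (g th) <= Rabs M0).
  { intros th Hth. eapply Rle_trans; [now apply HM0 | apply Rle_abs]. }
  assert (HM' : forall th, 0 <= th <= 2 * PI -> Cmod (g' th) <= Rabs M0').
  { intros th Hth. eapply Rle_trans; [now apply HM0' | apply Rle_abs]. }
  set (M := Rabs M0) in *. set (M' := Rabs M0') in *.
  assert (0 <= M) by apply Rabs_pos. assert (0 <= M') by apply Rabs_pos.
  split; [|split].
  - exists (M * M'). intros th Hth. rewrite Cmod_mult.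
    apply Rmult_le_compat; auto using Cmod_ge_0.
  - intros eps Heps.
    (* The three error terms below are at most [e * e], [e * M'] and [M * e]. With [e <= 1] they add
       up to at most [e * (M + M' + 1)], and the 2 in place of 1 makes the final inequality
       strict. *)
    set (e := Rmin 1 (eps / (M + M' + 2))).
    assert (He' : 0 < eps / (M + M' + 2)) by (apply Rdiv_lt_0_compat; lra).
    assert (He : 0 < e) by (apply Rmin_pos; lra).
    assert (He1 : e <= 1) by apply Rmin_l.
    assert (He2 : e * (M + M' + 2) <= eps).
    { apply Rle_trans with (eps / (M + M' + 2) * (M + M' + 2)).
      - apply Rmult_le_compat_r; [lra | apply Rmin_r].
      - right. field. lra. }
    apply for_small_t_imp with (2 := for_small_t_and _ _ (H1 _ He) (H1' _ He)).
    intros t th _ Hth [K1 K2].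
    replace (f t th * f' t th - (g th * g' th))%C
      with ((f t th - g th) * (f' t th - g' th) + (f t th - g th) * g' th
            + g th * (f' t th - g' th))%C by ring.
    eapply Rle_lt_trans; [apply Cmod_triangle|].
    eapply Rle_lt_trans; [apply Rplus_le_compat_r, Cmod_triangle|].
    rewrite !Cmod_mult.
    specialize (HM th Hth). specialize (HM' th Hth).
    pose proof (Cmod_ge_0 (f t th - g th)). pose proof (Cmod_ge_0 (f' t th - g' th)).
    pose proof (Cmod_ge_0 (g th)). pose proof (Cmod_ge_0 (g' th)).
    assert (Cmod (f t th - g th) * Cmod (f' t th - g' th) <= e * 1)
      by (apply Rmult_le_compat; lra).
    assert (Cmod (f t th - g th) * Cmod (g' th) <= e * M')
      by (apply Rmult_le_compat; lra).
    assert (Cmod (g th) * Cmod (f' t th - g' th) <= M * e)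
      by (apply Rmult_le_compat; lra).
    nra.
  - apply for_small_t_imp with (2 := for_small_t_and _ _ H2 H2').
    intros t th _ _ [K1 K2]. now apply cont_on_circle_mult.
Qed.

Lemma ulim_lower_bound (f : C -> R -> C) (g : R -> C) (m : R) :
  0 < m -> (forall th, 0 <= th <= 2 * PI -> m <= Cmod (g th)) -> ulim f g ->
  for_small_t (fun t th => m / 2 < Cmod (f t th)).
Proof.
  intros Hm Hg [_ [H1 _]].
  assert (Hm2 : 0 < m / 2) by lra.
  apply for_small_t_imp with (2 := H1 _ Hm2). intros t th _ Hth K.
  pose proof (Cmod_triangle (f t th) (g th - f t th)) as T.
  replace (f t th + (g th - f t th))%C with (g th) in T by ring.
  rewrite <- Cmod_opp in K. replace (- (f t th - g th))%C with (g th - f t th)%C in K by ring.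
  specialize (Hg th Hth). lra.
Qed.

Lemma Cmod_pos_neq0 (m : R) (z : C) : 0 < m -> m < Cmod z -> z <> 0%C.
Proof. intros Hm Hz ->. rewrite Cmod_0 in Hz. lra. Qed.

Lemma ulim_neq0 (f : C -> R -> C) (g : R -> C) (m : R) :
  0 < m -> (forall th, 0 <= th <= 2 * PI -> m <= Cmod (g th)) -> ulim f g ->
  for_small_t (fun t _ => forall th, 0 <= th <= 2 * PI -> f t th <> 0%C).
Proof.
  intros Hm Hg Hf. destruct (ulim_lower_bound f g m Hm Hg Hf) as [d [Hd H]].
  exists d; split; [exact Hd|]. intros t Ht _ _ th Hth.
  apply (Cmod_pos_neq0 (m / 2)); [lra | now apply H].
Qed.

Lemma ulim_inv (f : C -> R -> C) (g : R -> C) (m : R) :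
  0 < m -> (forall th, 0 <= th <= 2 * PI -> m <= Cmod (g th)) -> ulim f g ->
  ulim (fun t th => / f t th)%C (fun th => / g th)%C.
Proof.
  intros Hm Hg Hf.
  pose proof (ulim_lower_bound f g m Hm Hg Hf) as Hlow.
  pose proof (ulim_neq0 f g m Hm Hg Hf) as Hnz.
  destruct Hf as [_ [H1 H2]].
  assert (Hg0 : forall th, 0 <= th <= 2 * PI -> g th <> 0%C).
  { intros th Hth. apply (Cmod_pos_neq0 (m / 2)); [lra|]. specialize (Hg th Hth). lra. }
  split; [|split].
  - exists (/ m). intros th Hth. rewrite Cmod_inv by auto.
    apply Rinv_le_contravar; auto.
  - intros eps Heps.
    assert (Hmm : 0 < m / 2 * m) by nra.
    (* The difference of the inverses is [- (f - g) / (f * g)], and for small [t] the denominator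
       has modulus at least [m / 2 * m]. *)
    assert (He : 0 < eps * (m / 2 * m)) by (now apply Rmult_lt_0_compat).
    apply for_small_t_imp with (2 := for_small_t_and _ _ Hlow (H1 _ He)).
    intros t th _ Hth [K1 K2].
    assert (Hf0 : f t th <> 0%C) by (apply (Cmod_pos_neq0 (m / 2)); lra).
    specialize (Hg0 th Hth). specialize (Hg th Hth).
    replace (/ f t th - / g th)%C with (- (f t th - g th) / (f t th * g th))%C
      by (field; auto).
    rewrite Cmod_div by (now apply Cmult_neq_0).
    rewrite Cmod_opp, Cmod_mult.
    assert (m / 2 * m <= Cmod (f t th) * Cmod (g th)) by (apply Rmult_le_compat; lra).
    apply (Rmult_lt_reg_r (Cmod (f t th) * Cmod (g th))); [lra|].
    unfold Rdiv. rewrite Rmult_assoc, Rinv_l, Rmult_1_r by lra.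
    eapply Rlt_le_trans; [exact K2|].
    apply Rmult_le_compat_l; lra.
  - apply for_small_t_imp with (2 := for_small_t_and _ _ H2 Hnz).
    intros t th _ _ [K1 K2]. now apply cont_on_circle_inv.
Qed.

Lemma ulim_Im (f : C -> R -> C) (g : R -> C) :
  ulim f g ->
  ulim (fun t th => Complex.RtoC (Im (f t th))) (fun th => Complex.RtoC (Im (g th))).
Proof.
  assert (HI : forall z : C, Rabs (Im z) <= Cmod z).
  { intros z. eapply Rle_trans; [apply Rmax_r | apply Rmax_Cmod]. }
  intros [[M HM] [H1 H2]]. split; [|split].
  - exists M. intros th Hth. rewrite Cmod_R. eapply Rle_trans; [apply HI | now apply HM].
  - intros eps Heps. apply for_small_t_imp with (2 := H1 _ Heps).
    intros t th _ _ K. rewrite <- RtoC_minus, Cmod_R.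
    eapply Rle_lt_trans; [|exact K]. exact (HI (f t th - g th)%C).
  - apply for_small_t_imp with (2 := H2). intros t th _ _. apply cont_on_circle_Im.
Qed.

Lemma ln_Cmod_small (M : R) : for_small_t (fun t _ => ln (Cmod t) < - M).
Proof.
  exists (exp (- M)); split; [apply exp_pos|]. intros t Ht _ _.
  rewrite <- (ln_exp (- M)). apply ln_increasing; lra.
Qed.

(** This is why the constant factors in the symbols leave no trace in the limit. *)
Lemma ulim_inv_ln : ulim (fun t _ => Complex.RtoC (/ ln (Cmod t))) (fun _ => 0%C).
Proof.
  split; [|split].
  - exists 0. intros. rewrite Cmod_0. lra.
  - intros eps Heps. apply for_small_t_imp with (2 := ln_Cmod_small (/ eps)).
    intros t th _ _ K. assert (0 < / eps) by now apply Rinv_0_lt_compat.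
    rewrite <- RtoC_minus, Rminus_0_r, Cmod_R, Rabs_left by (apply Rinv_lt_0_compat; lra).
    rewrite <- Rinv_opp, <- (Rinv_inv eps). apply Rinv_lt_contravar; [|lra].
    apply Rmult_lt_0_compat; lra.
  - exists 1; split; [lra|]. intros t _ _ _. apply cont_on_circle_real.
    exists (fun _ => / ln (Cmod t)). intros. split; [reflexivity|].
    apply continuity_pt_const. now intros x y.
Qed.

(* The bounded quantity [ln |f|] is absorbed by the factor [1 / ln |t|]. *)
Lemma ulim_ln_ratio_bounded (f : C -> R -> C) (g : R -> C) (m : R) :
  0 < m -> (forall th, 0 <= th <= 2 * PI -> m <= Cmod (g th)) -> ulim f g ->
  ulim (fun t th => Complex.RtoC (ln (Cmod (f t th)) / ln (Cmod t))) (fun _ => 0%C).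
Proof.
  intros Hm Hg Hf.
  pose proof (ulim_lower_bound f g m Hm Hg Hf) as Hlow.
  pose proof (ulim_neq0 f g m Hm Hg Hf) as Hnz.
  destruct Hf as [[M HM] [H1 H2]].
  set (K := Rabs (ln (m / 2)) + Rabs (ln (Rabs M + 1))).
  assert (HK : 0 <= K) by (unfold K; apply Rplus_le_le_0_compat; apply Rabs_pos).
  assert (Hbd : for_small_t (fun t th => Rabs (ln (Cmod (f t th))) <= K)).
  { apply for_small_t_imp with (2 := for_small_t_and _ _ Hlow (H1 1 Rlt_0_1)).
    intros t th _ Hth [K1 K2].
    assert (K3 : Cmod (f t th) < Rabs M + 1).
    { pose proof (Cmod_triangle (f t th - g th) (g th)) as T.
      replace (f t th - g th + g th)%C with (f t th) in T by ring.
      specialize (HM th Hth). pose proof (Rle_abs M). lra. }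
    assert (L1 : ln (m / 2) < ln (Cmod (f t th))) by (apply ln_increasing; lra).
    assert (L2 : ln (Cmod (f t th)) < ln (Rabs M + 1)) by (apply ln_increasing; lra).
    unfold K. pose proof (Rle_abs (ln (Rabs M + 1))).
    pose proof (Rle_abs (- ln (m / 2))). rewrite Rabs_Ropp in *.
    pose proof (Rabs_pos (ln (m / 2))). pose proof (Rabs_pos (ln (Rabs M + 1))).
    apply Rabs_le. lra. }
  split; [|split].
  - exists 0. intros. rewrite Cmod_0. lra.
  - intros eps Heps.
    assert (He : 0 < eps / (K + 1)) by (apply Rdiv_lt_0_compat; lra).
    destruct ulim_inv_ln as [_ [H3 _]].
    apply for_small_t_imp with (2 := for_small_t_and _ _ Hbd (H3 _ He)).
    intros t th _ _ [K1 K2].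
    rewrite <- RtoC_minus, Rminus_0_r, Cmod_R in *. unfold Rdiv at 1. rewrite Rabs_mult.
    apply Rle_lt_trans with (K * Rabs (/ ln (Cmod t))).
    + apply Rmult_le_compat_r; [apply Rabs_pos | exact K1].
    + apply Rle_lt_trans with (K * (eps / (K + 1))).
      * apply Rmult_le_compat_l; lra.
      * apply Rlt_le_trans with ((K + 1) * (eps / (K + 1))).
        -- apply Rmult_lt_compat_r; lra.
        -- right. field. lra.
  - apply for_small_t_imp with (2 := for_small_t_and _ _ H2 Hnz).
    intros t th _ _ [K1 K2].
    apply cont_on_circle_ext
      with (fun th => Complex.RtoC (ln (Cmod (f t th))) * Complex.RtoC (/ ln (Cmod t)))%C.
    + intros x _. now rewrite <- RtoC_mult.
    + apply cont_on_circle_mult; [now apply cont_on_circle_ln_Cmod|].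
      apply cont_on_circle_real. exists (fun _ => / ln (Cmod t)). intros.
      split; [reflexivity|]. apply continuity_pt_const. now intros y z.
Qed.

(** * Logarithms and logarithmic derivatives near a node *)

Definition sumC {A : Type} (l : list A) (f : A -> C) : C :=
  fold_right (fun q acc => f q + acc)%C 0%C l.
(** A right fold, so that [Fpoly] is a [prodC] over the lines by conversion. *)
Definition prodC {A : Type} (l : list A) (f : A -> C) : C :=
  fold_right (fun q acc => f q * acc)%C 1%C l.

Lemma sumC_plus {A : Type} (l : list A) (f g : A -> C) :
  sumC l (fun q => f q + g q)%C = (sumC l f + sumC l g)%C.
Proof. induction l as [|q l IH]; simpl; [ring|]. rewrite IH. ring. Qed.

Lemma sumC_scal {A : Type} (l : list A) (z : C) (f : A -> C) :
  sumC l (fun q => z * f q)%C = (z * sumC l f)%C.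
Proof. induction l as [|q l IH]; simpl; [ring|]. rewrite IH. ring. Qed.

Lemma sumC_ext {A : Type} (l : list A) (f g : A -> C) :
  (forall q, In q l -> f q = g q) -> sumC l f = sumC l g.
Proof.
  induction l as [|q l IH]; simpl; intros H; [reflexivity|].
  rewrite (H q), IH; auto.
Qed.

Lemma sumC_zero {A : Type} (l : list A) : sumC l (fun _ => 0%C) = 0%C.
Proof. induction l as [|q l IH]; simpl; [reflexivity|]. rewrite IH. ring. Qed.

Lemma prodC_neq0 {A : Type} (l : list A) (f : A -> C) :
  (forall q, In q l -> f q <> 0%C) -> prodC l f <> 0%C.
Proof.
  induction l as [|q l IH]; simpl; intros H.
  - intros E. apply (f_equal fst) in E. simpl in E. lra.
  - apply Cmult_neq_0; auto.
Qed.

Lemma ln_Cmod_prodC {A : Type} (l : list A) (f : A -> C) :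
  (forall q, In q l -> f q <> 0%C) ->
  Complex.RtoC (ln (Cmod (prodC l f))) = sumC l (fun q => Complex.RtoC (ln (Cmod (f q)))).
Proof.
  induction l as [|q l IH]; simpl; intros H.
  - now rewrite Cmod_1, ln_1.
  - rewrite Cmod_mult, ln_mult, RtoC_plus, IH; auto.
    + apply Cmod_gt_0; auto.
    + apply Cmod_gt_0, prodC_neq0; auto.
Qed.

Lemma ulim_sumC {A : Type} (l : list A) (f : A -> C -> R -> C) (g : A -> R -> C) :
  (forall q, In q l -> ulim (f q) (g q)) ->
  ulim (fun t th => sumC l (fun q => f q t th)) (fun th => sumC l (fun q => g q th)).
Proof.
  induction l as [|q l IH]; intros H.
  - exact (ulim_const 0%C).
  - simpl. apply (ulim_plus (f q) (fun t th => sumC l (fun q => f q t th))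
                    (g q) (fun th => sumC l (fun q => g q th))).
    + apply H. now left.
    + apply IH. intros q' Hq'. apply H. now right.
Qed.

Definition cderiv (f : R -> C) (th : R) (d : C) : Prop :=
  derivable_pt_lim (fun x => Re (f x)) th (Re d) /\
  derivable_pt_lim (fun x => Im (f x)) th (Im d).

Lemma cderiv_eq (f : R -> C) (th : R) (d d' : C) : d = d' -> cderiv f th d -> cderiv f th d'.
Proof. now intros ->. Qed.

Lemma cderiv_const (z : C) (th : R) : cderiv (fun _ => z) th 0%C.
Proof. split; apply derivable_pt_lim_const. Qed.

Lemma cderiv_plus (f g : R -> C) (th : R) (d d' : C) :
  cderiv f th d -> cderiv g th d' -> cderiv (fun x => f x + g x)%C th (d + d')%C.
Proof.
  intros [H1 H2] [H3 H4]. split.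
  - exact (derivable_pt_lim_plus _ _ _ _ _ H1 H3).
  - exact (derivable_pt_lim_plus _ _ _ _ _ H2 H4).
Qed.

Lemma cderiv_mult (f g : R -> C) (th : R) (d d' : C) :
  cderiv f th d -> cderiv g th d' ->
  cderiv (fun x => f x * g x)%C th (d * g th + f th * d')%C.
Proof.
  intros [H1 H2] [H3 H4]. split.
  - replace (Re (d * g th + f th * d')%C) with
      ((Re d * Re (g th) + Re (f th) * Re d') - (Im d * Im (g th) + Im (f th) * Im d'))
      by (unfold Re, Im; simpl; ring).
    exact (derivable_pt_lim_minus _ _ _ _ _ (derivable_pt_lim_mult _ _ _ _ _ H1 H3)
             (derivable_pt_lim_mult _ _ _ _ _ H2 H4)).
  - replace (Im (d * g th + f th * d')%C) with
      ((Re d * Im (g th) + Re (f th) * Im d') + (Im d * Re (g th) + Im (f th) * Re d'))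
      by (unfold Re, Im; simpl; ring).
    exact (derivable_pt_lim_plus _ _ _ _ _ (derivable_pt_lim_mult _ _ _ _ _ H1 H4)
             (derivable_pt_lim_mult _ _ _ _ _ H2 H3)).
Qed.

Lemma cderiv_scal (z : C) (f : R -> C) (th : R) (d : C) :
  cderiv f th d -> cderiv (fun x => z * f x)%C th (z * d)%C.
Proof.
  intros H. eapply cderiv_eq; [|exact (cderiv_mult _ _ _ _ _ (cderiv_const z th) H)].
  cbv beta. ring.
Qed.

(** The derivative is given as product times sum of logarithmic derivatives, because the product of
    the lines will be divided out again. *)
Lemma cderiv_prodC {A : Type} (l : list A) (f : A -> R -> C) (d : A -> C) (th : R) :
  (forall q, In q l -> f q th <> 0%C) -> (forall q, In q l -> cderiv (f q) th (d q)) ->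
  cderiv (fun x => prodC l (fun q => f q x)) th
    (prodC l (fun q => f q th) * sumC l (fun q => d q / f q th))%C.
Proof.
  induction l as [|q l IH]; intros Hnz Hd; simpl.
  - eapply cderiv_eq; [|apply cderiv_const]. ring.
  - eapply cderiv_eq;
      [|apply (cderiv_mult (f q) (fun x => prodC l (fun q => f q x)) th (d q)
          (prodC l (fun q => f q th) * sumC l (fun q => d q / f q th))%C)].
    + field. apply Hnz. now left.
    + apply Hd. now left.
    + apply IH; intros; [apply Hnz | apply Hd]; now right.
Qed.

(** The curve equation is known only for angles in the segment, whereas the derivative is two-sided.
    At an end point, increments pointing into the segment are enough to force it to vanish. *)
Lemma derivable_pt_lim_const_segment (f : R -> R) (z A B th d : R) :
  A < B -> (forall x, A <= x <= B -> f x = z) -> A <= th <= B ->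
  derivable_pt_lim f th d -> d = 0.
Proof.
  intros HAB Hf Hth Hd.
  destruct (Req_dec d 0) as [E|E]; [exact E|]. exfalso.
  (* A difference quotient inside the segment is 0, so the tolerance [Rabs d] gives the
     contradiction [Rabs d < Rabs d]. *)
  destruct (Hd (Rabs d) (Rabs_pos_lt _ E)) as [del Hdel].
  pose proof (cond_pos del) as Hp.
  assert (exists h, h <> 0 /\ Rabs h < del /\ A <= th + h <= B) as [h [H1 [H2 H3]]].
  { destruct (Rlt_le_dec th B) as [H|H].
    - exists (Rmin (del / 2) (B - th)).
      assert (0 < Rmin (del / 2) (B - th)) by (apply Rmin_pos; lra).
      pose proof (Rmin_l (del / 2) (B - th)). pose proof (Rmin_r (del / 2) (B - th)).
      rewrite Rabs_pos_eq by lra. repeat split; lra.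
    - exists (- Rmin (del / 2) (th - A)).
      assert (0 < Rmin (del / 2) (th - A)) by (apply Rmin_pos; lra).
      pose proof (Rmin_l (del / 2) (th - A)). pose proof (Rmin_r (del / 2) (th - A)).
      rewrite Rabs_Ropp, Rabs_pos_eq by lra. repeat split; lra. }
  specialize (Hdel h H1 H2). rewrite !Hf in Hdel by lra.
  replace ((z - z) / h - d) with (- d) in Hdel by (field; exact H1).
  rewrite Rabs_Ropp in Hdel. lra.
Qed.

Lemma cderiv_const_segment (f : R -> C) (z : C) (A B th : R) (d : C) :
  A < B -> (forall x, A <= x <= B -> f x = z) -> A <= th <= B -> cderiv f th d -> d = 0%C.
Proof.
  intros HAB Hf Hth [H1 H2].
  apply (derivable_pt_lim_const_segment _ (Re z) A B) in H1;
    [|easy|intros; now rewrite Hf|easy].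
  apply (derivable_pt_lim_const_segment _ (Im z) A B) in H2;
    [|easy|intros; now rewrite Hf|easy].
  destruct d. simpl in *. now subst.
Qed.

Lemma cderiv_cont_on_circle (f d : R -> C) :
  (forall th, 0 <= th <= 2 * PI -> cderiv f th (d th)) -> cont_on_circle f.
Proof.
  intros H. exists f. intros th Hth. destruct (H th Hth) as [H1 H2].
  split; [reflexivity|]. split; apply derivable_continuous_pt; eexists; eassumption.
Qed.

(** [circ] and [dcirc] are convertible with the displacement in [circ_x] and with [circ_dx], but use
    the operations on [C] that [ring] and [field] recognise. *)
Definition circ (r th : R) : C := (Complex.RtoC r * (cos th, sin th)%R)%C.
Definition dcirc (r th : R) : C := (Complex.RtoC r * (- sin th, cos th)%R)%C.

Lemma cderiv_circ (r th : R) : cderiv (circ r) th (dcirc r th).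
Proof.
  apply cderiv_scal. split; simpl.
  - apply derivable_pt_lim_cos.
  - apply derivable_pt_lim_sin.
Qed.

Lemma cderiv_dcirc (r th : R) : cderiv (dcirc r) th (- circ r th)%C.
Proof.
  unfold dcirc, circ. eapply cderiv_eq;
    [|apply (cderiv_scal (Complex.RtoC r) (fun th => (- sin th, cos th)) th (- cos th, - sin th))].
  - apply injective_projections; simpl; ring.
  - split; simpl.
    + apply (derivable_pt_lim_opp sin), derivable_pt_lim_sin.
    + apply derivable_pt_lim_cos.
Qed.

Lemma Cmod_unit_circle (th : R) : Cmod (cos th, sin th) = 1.
Proof.
  unfold Cmod. simpl. transitivity (sqrt 1); [f_equal | apply sqrt_1].
  pose proof (sin2_cos2 th) as E. unfold Rsqr in E. lra.
Qed.

Lemma Cmod_circ (r th : R) : 0 < r -> Cmod (circ r th) = r.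
Proof.
  intros Hr. unfold circ. rewrite Cmod_mult, Cmod_unit_circle, Cmod_R, Rabs_pos_eq; lra.
Qed.

Lemma dcirc_Ci (r th : R) : dcirc r th = (Ci * circ r th)%C.
Proof. apply injective_projections; simpl; ring. Qed.

Lemma Cmod_dcirc (r th : R) : 0 < r -> Cmod (dcirc r th) = r.
Proof. intros Hr. rewrite dcirc_Ci, Cmod_mult, Cmod_Ci, Cmod_circ by exact Hr. ring. Qed.

Lemma ulim_circ (r : R) : 0 < r -> ulim (fun _ => circ r) (circ r).
Proof.
  intros Hr. apply ulim_fixed with r.
  - intros th _. rewrite Cmod_circ; lra.
  - apply cderiv_cont_on_circle with (dcirc r). intros. apply cderiv_circ.
Qed.

Lemma ulim_dcirc (r : R) : 0 < r -> ulim (fun _ => dcirc r) (dcirc r).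
Proof.
  intros Hr. apply ulim_fixed with r.
  - intros th _. rewrite Cmod_dcirc; lra.
  - apply cderiv_cont_on_circle with (fun th => (- circ r th)%C). intros. apply cderiv_dcirc.
Qed.

(* [l e kap bet] encode the lines other than the chosen one: on the circle of radius
   [r] around the node they are [e q + kap q * circ r th + bet q * u], where [u] is
   the value of the chosen line, which tends to 0. *)
Section ChosenBranch.
Variables (Q : Type) (l : list Q) (e kap bet : Q -> C) (r : R) (u du : C -> R -> C).
Hypothesis r_pos : 0 < r.
Hypothesis u_lim :
  forall eps, 0 < eps -> for_small_t (fun t th => Cmod (u t th) < eps).
Hypothesis u_deriv : for_small_t (fun t th => cderiv (u t) th (du t th)).

Let ell (q : Q) (th : R) : C := (e q + kap q * circ r th)%C.
Let L (q : Q) (t : C) (th : R) : C := (ell q th + bet q * u t th)%C.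
Let dL (q : Q) (t : C) (th : R) : C := (kap q * dcirc r th + bet q * du t th)%C.

Hypothesis u_prod : for_small_t (fun t th => (u t th * prodC l (fun q => L q t th))%C = t).
Hypothesis ell_lower : forall q, In q l ->
  exists m, 0 < m /\ forall th, 0 <= th <= 2 * PI -> m <= Cmod (ell q th).

Lemma branch_u_ulim : ulim u (fun _ => 0%C).
Proof.
  split; [|split].
  - exists 0. intros. rewrite Cmod_0. lra.
  - intros eps Heps. apply for_small_t_imp with (2 := u_lim eps Heps).
    intros t th _ _ H. now replace (u t th - 0)%C with (u t th) by ring.
  - destruct u_deriv as [d [Hd H]]. exists d. split; [exact Hd|]. intros t Ht _ _.
    apply cderiv_cont_on_circle with (du t). intros x Hx. now apply H.
Qed.

Lemma branch_L_ulim (q : Q) : ulim (L q) (ell q).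
Proof.
  eapply ulim_ext;
    [| |exact (ulim_plus _ _ _ _
         (ulim_plus _ _ _ _ (ulim_const (e q))
            (ulim_mult _ _ _ _ (ulim_const (kap q)) (ulim_circ r r_pos)))
         (ulim_mult _ _ _ _ (ulim_const (bet q)) branch_u_ulim))].
  - exists 1; split; [lra|]. reflexivity.
  - intros th _. unfold ell. simpl. ring.
Qed.

Lemma branch_L_inv_ulim (q : Q) :
  In q l -> ulim (fun t th => / L q t th)%C (fun th => / ell q th)%C.
Proof.
  intros Hq. destruct (ell_lower q Hq) as [m [Hm H]].
  apply ulim_inv with m; auto using branch_L_ulim.
Qed.

(** The other lines inherit a lower bound from their limits. No such bound exists for [u], which
    tends to 0; it is nonzero because it divides [t <> 0]. *)
Lemma branch_neq0 : for_small_t (fun t th =>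
  u t th <> 0%C /\ forall q, In q l -> L q t th <> 0%C).
Proof.
  assert (H : for_small_t (fun t th => forall q, In q l -> L q t th <> 0%C)).
  { apply for_small_t_list. intros q Hq. destruct (ell_lower q Hq) as [m [Hm H]].
    apply for_small_t_imp with (2 := ulim_neq0 _ _ m Hm H (branch_L_ulim q)).
    intros t th _ Hth K. now apply K. }
  apply for_small_t_imp with (2 := for_small_t_and _ _ u_prod H).
  intros t th Ht _ [K1 K2]. split; [|exact K2]. intros E. rewrite E in K1.
  rewrite Cmult_0_l in K1. rewrite <- K1, Cmod_0 in Ht. lra.
Qed.

(* Logarithmic derivative of [u * prod L = t]. *)
Lemma branch_log_deriv_sum : for_small_t (fun t th =>
  (du t th / u t th + sumC l (fun q => dL q t th / L q t th))%C = 0%C).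
Proof.
  destruct u_prod as [d1 [Hd1 H1]], branch_neq0 as [d2 [Hd2 H2]], u_deriv as [d3 [Hd3 H3]].
  exists (Rmin d1 (Rmin d2 d3)). split; [now repeat apply Rmin_pos|].
  intros t Ht th Hth.
  pose proof (Rmin_l d1 (Rmin d2 d3)). pose proof (Rmin_r d1 (Rmin d2 d3)).
  pose proof (Rmin_l d2 d3). pose proof (Rmin_r d2 d3).
  destruct (H2 t ltac:(lra) th Hth) as [Hu HL].
  specialize (H3 t ltac:(lra)).
  assert (HD : cderiv (fun x => u t x * prodC l (fun q => L q t x))%C th
     (t * (du t th / u t th + sumC l (fun q => dL q t th / L q t th)))%C).
  { assert (HdL : forall q, In q l -> cderiv (L q t) th (dL q t th)).
    { intros q _. unfold L, ell, dL.
      apply cderiv_plus; [|now apply cderiv_scal, H3].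
      eapply cderiv_eq; [|apply cderiv_plus;
        [apply cderiv_const | apply cderiv_scal, cderiv_circ]]. ring. }
    eapply cderiv_eq; [|exact (cderiv_mult _ _ _ _ _ (H3 th Hth)
                           (cderiv_prodC l (fun q => L q t) _ th HL HdL))].
    transitivity (u t th * prodC l (fun q => L q t th)
                  * (du t th / u t th + sumC l (fun q => dL q t th / L q t th)))%C.
    - cbv beta. field. exact Hu.
    - now rewrite (H1 t ltac:(lra) th Hth). }
  apply (cderiv_const_segment _ t 0 (2 * PI)) in HD;
    [|pose proof PI_RGT_0; lra|intros; apply H1; lra|exact Hth].
  assert (Ht0 : t <> 0%C) by (apply Cmod_gt_0; lra).
  rewrite <- (Cmult_1_l (_ + _)), <- (Cinv_l t Ht0), <- Cmult_assoc, HD. ring.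
Qed.

(** The solution for [du / u] of the equation [du / u + sum dL / L = 0]. Since
    [dL q = kap q * dcirc + bet q * du] and [du = u * (du / u)], the equation is linear in [du / u]
    with coefficient [1 + u * sum (bet / L)]. The right-hand side contains no derivative of [u], so
    its limit can be computed. *)
Let w (t : C) (th : R) : C :=
  (- (dcirc r th * sumC l (fun q => kap q * / L q t th))
   * / (1 + u t th * sumC l (fun q => bet q * / L q t th)))%C.

Let w_den_ulim :
  ulim (fun t th => 1 + u t th * sumC l (fun q => bet q * / L q t th))%C (fun _ => 1%C).
Proof.
  eapply ulim_ext;
    [| |exact (ulim_plus _ _ _ _ (ulim_const 1%C)
         (ulim_mult _ _ _ _ branch_u_ulim
            (ulim_sumC l (fun q t th => bet q * / L q t th)%C
               (fun q th => bet q * / ell q th)%C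
               (fun q Hq => ulim_mult _ _ _ _ (ulim_const (bet q)) (branch_L_inv_ulim q Hq)))))].
  - exists 1; split; [lra|]. reflexivity.
  - intros th _. simpl. ring.
Qed.

Lemma branch_log_deriv_u : for_small_t (fun t th => w t th = (du t th / u t th)%C).
Proof.
  assert (H1 : forall th, 0 <= th <= 2 * PI -> 1 <= Cmod 1)
    by (intros; rewrite Cmod_1; lra).
  apply for_small_t_imp with
    (2 := for_small_t_and _ _ branch_log_deriv_sum
            (for_small_t_and _ _ branch_neq0 (ulim_neq0 _ _ 1 Rlt_0_1 H1 w_den_ulim))).
  intros t th _ Hth [K1 [[Hu HL] K2]]. specialize (K2 th Hth). simpl in K2.
  assert (E : sumC l (fun q => dL q t th / L q t th)%C =
    (dcirc r th * sumC l (fun q => kap q * / L q t th)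
     + du t th * sumC l (fun q => bet q * / L q t th))%C).
  { rewrite <- !sumC_scal, <- sumC_plus. apply sumC_ext. intros q _.
    unfold dL, Complex.Cdiv. ring. }
  rewrite E in K1. unfold w.
  set (S1 := sumC l (fun q => kap q * / L q t th)%C) in *.
  set (S2 := sumC l (fun q => bet q * / L q t th)%C) in *.
  replace (- (dcirc r th * S1))%C with (du t th / u t th * (1 + u t th * S2))%C.
  - rewrite <- Cmult_assoc, Cinv_r, Cmult_1_r by exact K2. reflexivity.
  - replace (du t th / u t th * (1 + u t th * S2))%C
      with (du t th / u t th + (dcirc r th * S1 + du t th * S2) - dcirc r th * S1)%C
      by (field; exact Hu).
    rewrite K1. ring.
Qed.

Lemma branch_log_deriv_u_ulim :
  ulim (fun t th => du t th / u t th)%C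
       (fun th => - sumC l (fun q => kap q * dcirc r th / ell q th))%C.
Proof.
  assert (H1 : forall th, 0 <= th <= 2 * PI -> 1 <= Cmod 1)
    by (intros; rewrite Cmod_1; lra).
  assert (Hw : ulim w (fun th => - sumC l (fun q => kap q * dcirc r th / ell q th))%C).
  { eapply ulim_ext;
      [| |exact (ulim_mult _ _ _ _
         (ulim_mult _ _ _ _ (ulim_const (- (1))%C)
           (ulim_mult _ _ _ _ (ulim_dcirc r r_pos)
             (ulim_sumC l (fun q t th => kap q * / L q t th)%C
               (fun q th => kap q * / ell q th)%C
               (fun q Hq => ulim_mult _ _ _ _ (ulim_const (kap q)) (branch_L_inv_ulim q Hq)))))
         (ulim_inv _ _ 1 Rlt_0_1 H1 w_den_ulim))].
    - exists 1; split; [lra|]. intros. unfold w. f_equal. ring.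
    - intros th _. simpl.
      rewrite (sumC_ext l (fun q => kap q * dcirc r th / ell q th)%C
                 (fun q => dcirc r th * (kap q * / ell q th))%C)
        by (intros; unfold Complex.Cdiv; ring).
      rewrite sumC_scal. field. }
  eapply ulim_ext; [exact branch_log_deriv_u | reflexivity | exact Hw].
Qed.

(** [du] is the product of [u], which tends to 0, and [du / u], which has a bounded limit. The
    logarithmic derivatives of the other lines involve [du] through [bet]. *)
Lemma branch_du_ulim : ulim du (fun _ => 0%C).
Proof.
  eapply ulim_ext;
    [| |exact (ulim_mult _ _ _ _ branch_u_ulim branch_log_deriv_u_ulim)].
  - apply for_small_t_imp with (2 := branch_neq0). intros t th _ _ [Hu _]. simpl.
    field. exact Hu.
  - intros th _. simpl. ring.
Qed.

Lemma branch_log_deriv_L_ulim (q : Q) : In q l ->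
  ulim (fun t th => dL q t th / L q t th)%C (fun th => kap q * dcirc r th / ell q th)%C.
Proof.
  intros Hq.
  eapply ulim_ext;
    [| |exact (ulim_mult _ _ _ _
         (ulim_plus _ _ _ _
            (ulim_mult _ _ _ _ (ulim_const (kap q)) (ulim_dcirc r r_pos))
            (ulim_mult _ _ _ _ (ulim_const (bet q)) branch_du_ulim))
         (branch_L_inv_ulim q Hq))].
  - exists 1; split; [lra|]. reflexivity.
  - intros th _. simpl. unfold Complex.Cdiv. ring.
Qed.

Lemma branch_ln_L_ulim (q : Q) : In q l ->
  ulim (fun t th => Complex.RtoC (ln (Cmod (L q t th)) / ln (Cmod t))) (fun _ => 0%C).
Proof.
  intros Hq. destruct (ell_lower q Hq) as [m [Hm H]].
  exact (ulim_ln_ratio_bounded (L q) (ell q) m Hm H (branch_L_ulim q)).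
Qed.

Lemma branch_ln_u_ulim :
  ulim (fun t th => Complex.RtoC (ln (Cmod (u t th)) / ln (Cmod t))) (fun _ => 1%C).
Proof.
  eapply ulim_ext;
    [| |exact (ulim_plus _ _ _ _ (ulim_const 1%C)
         (ulim_mult _ _ _ _ (ulim_const (- (1))%C)
           (ulim_sumC l (fun q t th => Complex.RtoC (ln (Cmod (L q t th)) / ln (Cmod t)))
               (fun q th => 0%C) branch_ln_L_ulim)))].
  (* The logarithm of [u * prod L = t] gives [ln |u| = ln |t| - sum ln |L|]. The bound [ln |t| < -1]
     makes the division by [ln |t|] legitimate. *)
  - apply for_small_t_imp with
      (2 := for_small_t_and _ _ (ln_Cmod_small 1) (for_small_t_and _ _ u_prod branch_neq0)).
    intros t th Ht _ [K1 [K2 [Hu HL]]].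
    pose proof (prodC_neq0 l (fun q => L q t th) HL) as HP.
    assert (E : Complex.RtoC (ln (Cmod t)) = (Complex.RtoC (ln (Cmod (u t th)))
       + sumC l (fun q => Complex.RtoC (ln (Cmod (L q t th)))))%C).
    { rewrite <- ln_Cmod_prodC by exact HL. rewrite <- K2 at 1.
      rewrite Cmod_mult, ln_mult by (now apply Cmod_gt_0). apply RtoC_plus. }
    assert (Hln : Complex.RtoC (ln (Cmod t)) <> 0%C).
    { intros E0. apply RtoC_inj in E0. lra. }
    rewrite (sumC_ext l _ (fun q => / Complex.RtoC (ln (Cmod t))
                               * Complex.RtoC (ln (Cmod (L q t th))))%C).
    + rewrite sumC_scal.
      replace (sumC l (fun q => Complex.RtoC (ln (Cmod (L q t th)))))
        with (Complex.RtoC (ln (Cmod t)) - Complex.RtoC (ln (Cmod (u t th))))%C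
        by (rewrite E; ring).
      rewrite RtoC_div by lra. field. exact Hln.
    + intros q _. rewrite RtoC_div by lra. unfold Complex.Cdiv. ring.
  - intros th _. simpl. rewrite sumC_zero. ring.
Qed.

End ChosenBranch.

(** * Determinants and their limits *)

Definition tends (f : C -> R) (z : R) : Prop :=
  forall eps, 0 < eps -> exists del, 0 < del /\
    forall t, 0 < Cmod t < del -> Rabs (f t - z) < eps.

(** A function of [t] alone is a loop constant in the angle, so the rules for sums and products
    carry over from [ulim]. *)
Lemma tends_ulim (f : C -> R) (z : R) :
  tends f z <-> ulim (fun t _ => Complex.RtoC (f t)) (fun _ => Complex.RtoC z).
Proof.
  split.
  - intros H. split; [|split].
    + exists (Cmod (Complex.RtoC z)). intros. lra.
    + intros eps Heps. destruct (H eps Heps) as [d [Hd K]]. exists d. split; [exact Hd|].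
      intros t Ht th _. rewrite <- RtoC_minus, Cmod_R. now apply K.
    + exists 1. split; [lra|]. intros t _ th _. apply cont_on_circle_real.
      exists (fun _ => f t). intros. split; [reflexivity|].
      apply continuity_pt_const. now intros x y.
  - intros [_ [H _]] eps Heps. destruct (H eps Heps) as [d [Hd K]]. exists d.
    split; [exact Hd|]. intros t Ht. pose proof PI_RGT_0.
    specialize (K t Ht 0 ltac:(lra)). now rewrite <- RtoC_minus, Cmod_R in K.
Qed.

Lemma tends_const (z : R) : tends (fun _ => z) z.
Proof. apply tends_ulim, ulim_const. Qed.

Lemma tends_plus (f g : C -> R) (y z : R) :
  tends f y -> tends g z -> tends (fun t => f t + g t) (y + z).
Proof.
  rewrite !tends_ulim. intros H1 H2.
  eapply ulim_ext; [| |exact (ulim_plus _ _ _ _ H1 H2)].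
  - exists 1. split; [lra|]. intros. symmetry. apply RtoC_plus.
  - intros. symmetry. apply RtoC_plus.
Qed.

Lemma tends_mult (f g : C -> R) (y z : R) :
  tends f y -> tends g z -> tends (fun t => f t * g t) (y * z).
Proof.
  rewrite !tends_ulim. intros H1 H2.
  eapply ulim_ext; [| |exact (ulim_mult _ _ _ _ H1 H2)].
  - exists 1. split; [lra|]. intros. symmetry. apply RtoC_mult.
  - intros. symmetry. apply RtoC_mult.
Qed.

Lemma tends_ext (f g : C -> R) (z : R) :
  (forall t, f t = g t) -> tends f z -> tends g z.
Proof.
  intros E H eps Heps. destruct (H eps Heps) as [d [Hd K]]. exists d.
  split; [exact Hd|]. intros t Ht. rewrite <- E. now apply K.
Qed.

Lemma tends_sumR (n : nat) (f : nat -> C -> R) (z : nat -> R) :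
  (forall k, (k < n)%nat -> tends (f k) (z k)) ->
  tends (fun t => sumR n (fun k => f k t)) (sumR n z).
Proof.
  induction n as [|n IH]; intros H; simpl.
  - apply tends_const.
  - apply tends_plus; [apply IH; intros | ]; apply H; lia.
Qed.

Lemma sumR_ext (n : nat) (f g : nat -> R) :
  (forall k, (k < n)%nat -> f k = g k) -> sumR n f = sumR n g.
Proof.
  induction n as [|n IH]; intros H; simpl; [reflexivity|].
  rewrite IH, H; [reflexivity|lia|]. intros. apply H. lia.
Qed.

Lemma sumR_scal (n : nat) (f : nat -> R) (z : R) :
  sumR n (fun k => f k * z) = sumR n f * z.
Proof. induction n as [|n IH]; simpl; [ring|]. rewrite IH. ring. Qed.

Lemma sumR_single (n j : nat) (f : nat -> R) :
  (j < n)%nat -> (forall k, (k < n)%nat -> k <> j -> f k = 0) -> sumR n f = f j.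
Proof.
  induction n as [|n IH]; intros Hj H; simpl; [lia|].
  destruct (Nat.eq_dec j n) as [->|E].
  - replace (sumR n f) with (sumR n (fun _ => 0 * 0)).
    + rewrite sumR_scal. ring.
    + apply sumR_ext. intros k Hk. rewrite H by lia. ring.
  - rewrite IH, (H n) by (try lia; intros; apply H; lia). ring.
Qed.

Lemma det_ext (n : nat) (M M' : nat -> nat -> R) :
  (forall u v, (u < n)%nat -> (v < n)%nat -> M u v = M' u v) -> det n M = det n M'.
Proof.
  revert M M'. induction n as [|n IH]; intros M M' H; [reflexivity|].
  apply sumR_ext. intros k Hk. rewrite H by lia. f_equal.
  apply IH. intros u v Hu Hv. apply H; [lia|]. destruct (Nat.ltb v k); lia.
Qed.

Lemma det_scal (n : nat) (M : nat -> nat -> R) (z : R) :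
  det n (fun u v => M u v * z) = det n M * z ^ n.
Proof.
  revert M. induction n as [|n IH]; intros M; [simpl; ring|].
  change (sumR (S n) (fun j => (-1) ^ j * (M O j * z)
            * det n (fun u v => minor M j u v * z))
          = sumR (S n) (fun j => (-1) ^ j * M O j * det n (minor M j)) * z ^ S n).
  rewrite <- sumR_scal. apply sumR_ext. intros k _. rewrite IH. simpl. ring.
Qed.

Lemma det_tends (n : nat) (M : C -> nat -> nat -> R) (M0 : nat -> nat -> R) :
  (forall u v, (u < n)%nat -> (v < n)%nat -> tends (fun t => M t u v) (M0 u v)) ->
  tends (fun t => det n (M t)) (det n M0).
Proof.
  revert M M0. induction n as [|n IH]; intros M M0 H; [exact (tends_const 1)|].
  apply (tends_sumR (S n) (fun j t => (-1) ^ j * M t O j * det n (minor (M t) j))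
           (fun j => (-1) ^ j * M0 O j * det n (minor M0 j))).
  intros k Hk. apply tends_mult; [apply tends_mult; [apply tends_const|apply H; lia]|].
  apply IH. intros u v Hu Hv. apply H; [lia|]. destruct (Nat.ltb v k); lia.
Qed.

(** The index on the left is the column index in [minor] when the column [length l1] is deleted. *)
Lemma nth_remove {A : Type} (d x : A) (l1 l2 : list A) (k : nat) :
  nth (if Nat.ltb k (length l1) then k else S k) (l1 ++ x :: l2) d = nth k (l1 ++ l2) d.
Proof.
  destruct (Nat.ltb_spec k (length l1)) as [H|H].
  - now rewrite !app_nth1.
  - rewrite !app_nth2 by lia. now replace (S k - length l1)%nat with (S (k - length l1)) by lia.
Qed.

(** In the first row only the column of [phi x] can be nonzero, as every other column is matched
    with a later row. Laplace expansion thus leaves one minor, whose columns are matched with the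
    remaining rows in the same way. The position of the column contributes the uncontrolled sign
    [(-1) ^ length c1]. *)
Lemma det_unit_matching {A B : Type} (dA : A) (dB : B) (f : A -> B -> R) (phi : A -> B)
  (rows : list A) (cols : list B) :
  Permutation (map phi rows) cols ->
  (forall x, In x rows -> f x (phi x) = 1 \/ f x (phi x) = -1) ->
  ForallOrdPairs (fun x x' => f x (phi x') = 0) rows ->
  let d := det (length rows) (fun u v => f (nth u rows dA) (nth v cols dB)) in
  d = 1 \/ d = -1.
Proof.
  revert cols. induction rows as [|x rows IH]; intros cols HP H1 H0 d; [now left|].
  destruct (in_split (phi x) cols) as [c1 [c2 ->]].
  { apply (Permutation_in _ HP). now left. }
  apply Permutation_cons_app_inv in HP. fold (map phi rows) in HP.
  inversion H0 as [|? ? Hx H0']; subst. rewrite Forall_forall in Hx.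
  assert (Hlen : length rows = (length c1 + length c2)%nat).
  { rewrite <- length_app, <- (Permutation_length HP). symmetry. apply length_map. }
  assert (Ed : d = (-1) ^ length c1 * f x (phi x) *
     det (length rows) (fun u v => f (nth u rows dA) (nth v (c1 ++ c2) dB))).
  { unfold d. change (length (x :: rows)) with (S (length rows)). cbn [det].
    rewrite (sumR_single (S (length rows)) (length c1)).
    - cbn [nth]. rewrite nth_middle. f_equal. apply det_ext. intros u v _ _.
      unfold minor. cbn [nth]. now rewrite nth_remove.
    - lia.
    - intros k Hk Hne.
      (* A column at a position other than [length c1] survives the removal of [phi x], hence is
         [phi x'] for a later row [x']. *)
      assert (HI : In (nth k (c1 ++ phi x :: c2) dB) (c1 ++ c2)).
      { apply in_or_app. destruct (Nat.ltb_spec k (length c1)) as [L|L].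
        - rewrite app_nth1 by exact L. left. now apply nth_In.
        - rewrite app_nth2 by exact L.
          replace (k - length c1)%nat with (S (k - length c1 - 1)) by lia.
          right. cbn [nth]. apply nth_In. lia. }
      apply (Permutation_in _ (Permutation_sym HP)), in_map_iff in HI.
      destruct HI as [x' [<- Hx']]. cbn [nth]. rewrite (Hx x' Hx'). ring. }
  assert (Hs : (-1) ^ length c1 = 1 \/ (-1) ^ length c1 = -1).
  { generalize (length c1). intros m.
    induction m as [|m [IHm|IHm]]; simpl; [now left | right; lra | left; lra]. }
  rewrite Ed.
  destruct (IH (c1 ++ c2) HP (fun y Hy => H1 y (or_intror Hy)) H0') as [-> | ->],
    Hs as [-> | ->], (H1 x (or_introl eq_refl)) as [-> | ->]; lra.
Qed.

(** * Integrals over the loop *)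

Lemma RInt_is_RInt (f : R -> R) (x y v : R) : is_RInt f x y v -> Defs.RInt f x y = v.
Proof.
  intros H. unfold Defs.RInt.
  destruct (excluded_middle_informative (inhabited (Riemann_integrable f x y))) as [i|n].
  - rewrite <- RInt_Reals. now apply is_RInt_unique.
  - elim n. constructor. apply ex_RInt_Reals_0. now exists v.
Qed.

Lemma cont_on_circle_ex_RInt (f : R -> R) :
  cont_on_circle (fun th => Complex.RtoC (f th)) -> ex_RInt f 0 (2 * PI).
Proof.
  pose proof PI_RGT_0 as Hpi.
  intros [g H]. apply ex_RInt_ext with (fun th => Re (g th)).
  - rewrite Rmin_left, Rmax_right by lra. intros x Hx.
    destruct (H x) as [-> _]; [lra | reflexivity].
  - apply (ex_RInt_continuous (V := R_CompleteNormedModule)). rewrite Rmin_left, Rmax_right by lra. intros x Hx.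
    apply continuity_pt_filterlim. now apply H.
Qed.

Lemma ulim_RInt (f : C -> R -> R) (g : R -> R) (v : R) :
  ulim (fun t th => Complex.RtoC (f t th)) (fun th => Complex.RtoC (g th)) ->
  is_RInt g 0 (2 * PI) v -> tends (fun t => Defs.RInt (f t) 0 (2 * PI)) v.
Proof.
  pose proof PI_RGT_0 as Hpi.
  intros [_ [H1 [d2 [Hd2 H2]]]] Hg eps Heps.
  (* Over an interval of length [2 * PI] this gives the bound [eps / 2]; the factor 2 to spare turns
     a weak inequality into a strict one. *)
  assert (He : 0 < eps / (4 * PI)) by (apply Rdiv_lt_0_compat; lra).
  destruct (H1 _ He) as [d1 [Hd1 K]].
  exists (Rmin d1 d2). split; [now apply Rmin_pos|]. intros t Ht.
  pose proof (Rmin_l d1 d2). pose proof (Rmin_r d1 d2).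
  assert (Hf : ex_RInt (f t) 0 (2 * PI)).
  { apply cont_on_circle_ex_RInt. apply (H2 t) with 0; lra. }
  destruct Hf as [y Hy]. rewrite (RInt_is_RInt _ _ _ _ Hy).
  assert (Hm : is_RInt (fun th => f t th - g th) 0 (2 * PI) (y - v))
    by exact (is_RInt_minus (V := R_NormedModule) _ _ _ _ _ _ Hy Hg).
  assert (B : Rabs (Coquelicot.RInt.RInt (fun th => f t th - g th) 0 (2 * PI))
              <= (2 * PI - 0) * (eps / (4 * PI))).
  { apply abs_RInt_le_const; [lra | eexists; exact Hm |]. intros th Hth.
    specialize (K t ltac:(lra) th Hth). rewrite <- RtoC_minus, Cmod_R in K.
    apply Rlt_le. exact K. }
  rewrite (is_RInt_unique _ _ _ _ Hm) in B.
  replace ((2 * PI - 0) * (eps / (4 * PI))) with (eps / 2) in B by (field; lra).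
 lra.
Qed.

Lemma is_RInt_const_R (x y z : R) : is_RInt (fun _ => z) x y ((y - x) * z).
Proof. exact (is_RInt_const (V := R_NormedModule) x y z). Qed.

Lemma is_RInt_zero (x y : R) : is_RInt (fun _ => 0) x y 0.
Proof. pose proof (is_RInt_const_R x y 0) as H. now rewrite Rmult_0_r in H. Qed.

(** [dcirc] is [Ci] times [circ], so the quotient is the constant [Ci]. *)
Lemma is_RInt_log_deriv_node (r : R) (kap : C) : 0 < r -> kap <> 0%C ->
  is_RInt (fun th => Im (kap * dcirc r th / (0 + kap * circ r th))%C) 0 (2 * PI) (2 * PI).
Proof.
  intros Hr Hk.
  apply is_RInt_ext with (fun _ => 1).
  - intros th _.
    assert (circ r th <> 0%C) by (apply Cmod_gt_0; rewrite Cmod_circ; lra).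
    replace (kap * dcirc r th / (0 + kap * circ r th))%C with Ci; [reflexivity|].
    rewrite dcirc_Ci. field. split; assumption.
  - replace (2 * PI) with ((2 * PI - 0) * 1) at 2 by ring. apply is_RInt_const_R.
Qed.

Lemma Im_Cdiv (z w : C) : w <> 0%C ->
  Im (z / w)%C = (Im z * Re w - Re z * Im w) / (Re w ^ 2 + Im w ^ 2).
Proof.
  intros Hw. apply sum_sqr_pos in Hw. destruct z, w. unfold Re, Im. simpl in *.
  field. lra.
Qed.

(* With [rho = kap r / e] of modulus [< 1], [1 + rho e^{i th}] stays in the right
   half plane, where [atan (Im / Re)] is a continuous argument. *)
Lemma is_RInt_log_deriv_far (r : R) (e kap : C) : 0 < r -> Cmod kap * r < Cmod e ->
  is_RInt (fun th => Im (kap * dcirc r th / (e + kap * circ r th))%C) 0 (2 * PI) 0.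
Proof.
  intros Hr He.
  assert (He0 : 0 < Cmod e) by (pose proof (Cmod_ge_0 kap); nra).
  assert (Hez : e <> 0%C) by now apply Cmod_gt_0.
  destruct (kap * Complex.RtoC r / e)%C as [p q] eqn:Erho.
  assert (Hrho : Cmod (p, q) < 1).
  { rewrite <- Erho, Cmod_div, Cmod_mult, Cmod_R, (Rabs_pos_eq r) by (try assumption; lra).
    apply (Rmult_lt_reg_r (Cmod e)); [exact He0|].
    unfold Rdiv. rewrite Rmult_assoc, Rinv_l; lra. }
  set (X := fun th => 1 + p * cos th - q * sin th).
  set (Y := fun th => p * sin th + q * cos th).
  assert (HX : forall th, 0 < X th).
  { intros th. pose proof (re_le_Cmod ((p, q) * (cos th, sin th)%R)%C) as B.
    rewrite Cmod_mult, Cmod_unit_circle in B. simpl in B. unfold X.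
    pose proof (Rle_abs (- (p * cos th - q * sin th))). rewrite Rabs_Ropp in *. lra. }
  assert (HN : forall th, 0 < X th ^ 2 + Y th ^ 2).
  { intros th. pose proof (pow_lt _ 2 (HX th)). pose proof (pow2_ge_0 (Y th)). lra. }
  assert (HE : forall th, Im (kap * dcirc r th / (e + kap * circ r th))%C
     = ((X th - 1) * X th + Y th * Y th) / (X th ^ 2 + Y th ^ 2)).
  { intros th.
    assert (Hnz : (1 + (p, q) * (cos th, sin th)%R)%C <> 0%C).
    { intros E. apply (f_equal fst) in E. simpl in E. specialize (HX th). unfold X in HX. lra. }
    replace (kap * dcirc r th / (e + kap * circ r th))%C
      with ((p, q) * (Ci * (cos th, sin th)%R) / (1 + (p, q) * (cos th, sin th)%R))%C.
    - rewrite Im_Cdiv by exact Hnz. unfold X, Y, Re, Im. simpl. f_equal; ring.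
    - rewrite dcirc_Ci. unfold circ. rewrite <- Erho in *. field. split; [|assumption].
      intros E. apply Hnz.
      replace (1 + kap * Complex.RtoC r / e * (cos th, sin th)%R)%C
        with ((e + kap * (Complex.RtoC r * (cos th, sin th)%R)) / e)%C by (field; assumption).
      rewrite E. field. assumption. }
  apply is_RInt_ext with (fun th => ((X th - 1) * X th + Y th * Y th) / (X th ^ 2 + Y th ^ 2)).
  { intros. symmetry. apply HE. }
  replace 0 with (minus (atan (Y (2 * PI) / X (2 * PI))) (atan (Y 0 / X 0))) at 2.
  - apply (is_RInt_derive (fun th => atan (Y th / X th))).
    + intros th _. specialize (HX th). specialize (HN th). unfold X, Y in *.
      auto_derive; [lra|]. field. lra.
    + intros th _. apply (ex_derive_continuous (V := R_NormedModule)).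
      specialize (HN th). unfold X, Y in *. auto_derive. lra.
  - unfold minus, plus, opp; simpl. unfold X, Y.
    rewrite sin_2PI, cos_2PI, sin_0, cos_0. ring.
Qed.

(** * The limit matrix *)

Lemma pair_nat_eq_dec (p q : nat * nat) : {p = q} + {p <> q}.
Proof. decide equality; apply Nat.eq_dec. Qed.

(* Order of vanishing of the component along the line [p]. *)
Definition comp_ord (p : nat * nat) (A : comp) : R :=
  match A with (_, num, den) =>
    (if pair_nat_eq_dec p num then 1 else 0) - (if pair_nat_eq_dec p den then 1 else 0)
  end.

(** The 2 by 2 determinant of the orders of the two components along the two lines. *)
Definition tame_ord (p q : nat * nat) (al : symb) : R :=
  comp_ord p (fst al) * comp_ord q (snd al) - comp_ord q (fst al) * comp_ord p (snd al).

Definition other_line (ch : quad -> bool) (s : quad) : nat * nat :=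
  chosen_line (fun s => negb (ch s)) s.

Definition limit_entry (ch : quad -> bool) (s : quad) (al : symb) : R :=
  tame_ord (chosen_line ch s) (other_line ch s) al.

(* The column matched with the row of a node, so that the limit matrix becomes
   triangular with entries [1] and [-1] on the diagonal. *)
Definition matched_symb (a b : nat -> C) (s : quad) : symb :=
  match s with (i, j, k, l) =>
    if Nat.eqb i 1 then
      if Nat.eqb k 2 then Rsym 1 1 j 2 1 l else Tsym a b 1 j 2 1 k l
    else Tsym a b 1 1 i j k l
  end.

(** * Matching the nodes with the symbols *)

Lemma In_all_quads (N : nat) (Ns : nat -> nat) (i j k l : nat) :
  In (i, j, k, l) (all_quads N Ns) <->
  (1 <= i < k /\ k <= N /\ 1 <= j <= Ns i /\ 1 <= l <= Ns k)%nat.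
Proof.
  unfold all_quads, range1. split.
  - intros H. apply in_flat_map in H. destruct H as [i' [Hi H]].
    apply in_flat_map in H. destruct H as [k' [Hk H]].
    apply in_flat_map in H. destruct H as [j' [Hj H]].
    apply in_map_iff in H. destruct H as [l' [E Hl]]. injection E as -> -> -> ->.
    rewrite in_seq in *. lia.
  - intros H. apply in_flat_map. exists i. split; [apply in_seq; lia|].
    apply in_flat_map. exists k. split; [apply in_seq; lia|].
    apply in_flat_map. exists j. split; [apply in_seq; lia|].
    apply in_map_iff. exists l. split; [reflexivity | apply in_seq; lia].
Qed.

Lemma In_S_list (N : nat) (Ns : nat -> nat) (i j k l : nat) :
  In (i, j, k, l) (S_list N Ns) <->
  ((1 <= i < k /\ k <= N /\ 1 <= j <= Ns i /\ 1 <= l <= Ns k) /\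
   (i = 1 -> 2 <= j /\ (k = 2 -> 2 <= l)))%nat.
Proof.
  unfold S_list. rewrite filter_In, In_all_quads.
  destruct (Nat.eqb_spec i 1), (Nat.eqb_spec j 1), (Nat.eqb_spec k 2), (Nat.eqb_spec l 1);
    simpl; intuition (try discriminate; try lia).
Qed.

(** The key recovers the outer index from an element, so blocks with different indices are
    disjoint. *)
Lemma NoDup_flat_map_key {A B : Type} (key : B -> A) (f : A -> list B) (l : list A) :
  (forall x, In x l -> NoDup (f x) /\ forall y, In y (f x) -> key y = x) ->
  NoDup l -> NoDup (flat_map f l).
Proof.
  induction l as [|x l IH]; intros Hf Hl; simpl; [constructor|].
  inversion Hl as [|? ? Hx Hl']; subst. apply NoDup_app.
  - apply Hf. now left.
  - apply IH; [|exact Hl']. intros x' Hx'. apply Hf. now right.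
  - intros y Hy Hy'. apply in_flat_map in Hy'. destruct Hy' as [x' [Hx' Hy']].
    apply Hf in Hy; [|now left]. apply Hf in Hy'; [|now right]. congruence.
Qed.

Lemma NoDup_map_seq {A : Type} (f : nat -> A) (m n : nat) :
  (forall x y, f x = f y -> x = y) -> NoDup (map f (seq m n)).
Proof. intros H. apply FinFun.Injective_map_NoDup; [exact H | apply seq_NoDup]. Qed.

Ltac key_by_indices :=
  let y := fresh in
  intros [[[? ?] ?] ?] y;
  repeat (rewrite in_flat_map in y; destruct y as [? [_ y]]);
  rewrite in_map_iff in y; destruct y as [? [y _]]; injection y; intros; subst; reflexivity.

Lemma NoDup_all_quads (N : nat) (Ns : nat -> nat) : NoDup (all_quads N Ns).
Proof.
  unfold all_quads.
  apply (NoDup_flat_map_key (fun s => match s with (i, _, _, _) => i end));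
    [intros i _; split; [|key_by_indices] | apply seq_NoDup].
  apply (NoDup_flat_map_key (fun s => match s with (_, _, k, _) => k end));
    [intros k _; split; [|key_by_indices] | apply seq_NoDup].
  apply (NoDup_flat_map_key (fun s => match s with (_, j, _, _) => j end));
    [intros j _; split; [|key_by_indices] | apply seq_NoDup].
  apply NoDup_map_seq. now intros x y [=].
Qed.

(** The nodes in the order of their symbols: mapping [matched_symb] over this list gives
    [alpha_list] exactly, with no reordering. *)
Definition alpha_quads (N : nat) (Ns : nat -> nat) : list quad :=
  flat_map (fun j => map (fun m => (1, j, 2, m)%nat) (seq 2 (Ns 2%nat - 1)))
    (seq 2 (Ns 1%nat - 1))
  ++
  flat_map (fun k => flat_map (fun m => flat_map (fun l =>
    map (fun n => (k, l, m, n)) (range1 (Ns m))) (range1 (Ns k))) (seq (S k) (N - k)))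
    (seq 2 (N - 1))
  ++
  flat_map (fun j => flat_map (fun m =>
    map (fun n => (1%nat, j, m, n)) (range1 (Ns m))) (seq 3 (N - 2)))
    (seq 2 (Ns 1%nat - 1)).

Lemma map_flat_map_in {A B D : Type} (f : B -> D) (g : A -> list B) (h : A -> list D)
  (l : list A) :
  (forall x, In x l -> map f (g x) = h x) -> map f (flat_map g l) = flat_map h l.
Proof.
  induction l as [|x l IH]; intros H; simpl; [reflexivity|].
  rewrite map_app, H, IH; [reflexivity | intros; apply H; now right | now left].
Qed.

Lemma alpha_list_map (N : nat) (Ns : nat -> nat) (a b : nat -> C) :
  alpha_list N Ns a b = map (matched_symb a b) (alpha_quads N Ns).
Proof.
  unfold alpha_list, alpha_quads. rewrite !map_app. symmetry. f_equal; [|f_equal].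
  - apply map_flat_map_in. intros j _. apply map_map.
  - apply map_flat_map_in. intros k Hk. apply in_seq in Hk.
    apply map_flat_map_in. intros m _. apply map_flat_map_in. intros l _.
    rewrite map_map. apply map_ext. intros n. simpl.
    destruct (Nat.eqb_spec k 1); [lia | reflexivity].
  - apply map_flat_map_in. intros j _. apply map_flat_map_in. intros m Hm.
    apply in_seq in Hm. rewrite map_map. apply map_ext. intros n. simpl.
    destruct (Nat.eqb_spec m 2); [lia | reflexivity].
Qed.

(** The three families of symbols correspond to the nodes with [i = 1] and [k = 2], with [i >= 2],
    and with [i = 1] and [k >= 3]. *)
Lemma In_alpha_quads (N : nat) (Ns : nat -> nat) (i j k l : nat) : (2 <= N)%nat ->
  In (i, j, k, l) (alpha_quads N Ns) <-> In (i, j, k, l) (S_list N Ns).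
Proof.
  intros HN. rewrite In_S_list. unfold alpha_quads, range1.
  rewrite !in_app_iff, !in_flat_map. split.
  - intros [[j' [Hj H]]|[[k' [Hk H]]|[j' [Hj H]]]].
    + apply in_map_iff in H. destruct H as [m [E Hm]]. injection E as <- <- <- <-.
      rewrite in_seq in *. lia.
    + apply in_flat_map in H. destruct H as [m [Hm H]].
      apply in_flat_map in H. destruct H as [l' [Hl H]].
      apply in_map_iff in H. destruct H as [n [E Hn]]. injection E as <- <- <- <-.
      rewrite in_seq in *. lia.
    + apply in_flat_map in H. destruct H as [m [Hm H]].
      apply in_map_iff in H. destruct H as [n [E Hn]]. injection E as <- <- <- <-.
      rewrite in_seq in *. lia.
  - intros [H1 H2]. destruct (Nat.eq_dec i 1) as [->|Hi].
    + destruct (Nat.eq_dec k 2) as [->|Hk].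
      * left. exists j. split; [apply in_seq; lia|]. apply in_map_iff. exists l.
        split; [reflexivity | apply in_seq; lia].
      * right; right. exists j. split; [apply in_seq; lia|]. apply in_flat_map. exists k.
        split; [apply in_seq; lia|]. apply in_map_iff. exists l.
        split; [reflexivity | apply in_seq; lia].
    + right; left. exists i. split; [apply in_seq; lia|]. apply in_flat_map. exists k.
      split; [apply in_seq; lia|]. apply in_flat_map. exists j. split; [apply in_seq; lia|].
      apply in_map_iff. exists l. split; [reflexivity | apply in_seq; lia].
Qed.

Lemma NoDup_alpha_quads (N : nat) (Ns : nat -> nat) : NoDup (alpha_quads N Ns).
Proof.
  unfold alpha_quads. apply NoDup_app; [|apply NoDup_app|].
  - apply (NoDup_flat_map_key (fun s => match s with (_, j, _, _) => j end));
      [intros j _; split; [|key_by_indices] | apply seq_NoDup].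
    apply NoDup_map_seq. now intros x y [=].
  - apply (NoDup_flat_map_key (fun s => match s with (k, _, _, _) => k end));
      [intros k _; split; [|key_by_indices] | apply seq_NoDup].
    apply (NoDup_flat_map_key (fun s => match s with (_, _, m, _) => m end));
      [intros m _; split; [|key_by_indices] | apply seq_NoDup].
    apply (NoDup_flat_map_key (fun s => match s with (_, l, _, _) => l end));
      [intros l _; split; [|key_by_indices] | apply seq_NoDup].
    apply NoDup_map_seq. now intros x y [=].
  - apply (NoDup_flat_map_key (fun s => match s with (_, j, _, _) => j end));
      [intros j _; split; [|key_by_indices] | apply seq_NoDup].
    apply (NoDup_flat_map_key (fun s => match s with (_, _, m, _) => m end));
      [intros m _; split; [|key_by_indices] | apply seq_NoDup].
    apply NoDup_map_seq. now intros x y [=].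
  - intros [[[i j] k] l] H1 H2. apply in_flat_map in H1, H2.
    destruct H1 as [x [Hx H1]], H2 as [y [_ H2]]. apply in_flat_map in H2.
    destruct H2 as [m [_ H2]]. apply in_map_iff in H2. destruct H2 as [n [E _]].
    injection E as <- <- <- <-. apply in_seq in Hx.
    apply in_flat_map in H1. destruct H1 as [? [_ H1]].
    apply in_flat_map in H1. destruct H1 as [? [_ H1]].
    apply in_map_iff in H1. destruct H1 as [? [E _]]. injection E. lia.
  - intros [[[i j] k] l] H1 H2. apply in_flat_map in H1.
    destruct H1 as [x [_ H1]]. apply in_map_iff in H1. destruct H1 as [? [E _]].
    injection E as <- <- <- <-. apply in_app_or in H2. destruct H2 as [H2|H2].
    + apply in_flat_map in H2. destruct H2 as [y [Hy H2]]. apply in_seq in Hy.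
      apply in_flat_map in H2. destruct H2 as [? [_ H2]].
      apply in_flat_map in H2. destruct H2 as [? [_ H2]].
      apply in_map_iff in H2. destruct H2 as [? [E _]]. injection E. lia.
    + apply in_flat_map in H2. destruct H2 as [? [_ H2]].
      apply in_flat_map in H2. destruct H2 as [y [Hy H2]]. apply in_seq in Hy.
      apply in_map_iff in H2. destruct H2 as [? [E _]]. injection E. lia.
Qed.

Lemma S_list_alpha_quads (N : nat) (Ns : nat -> nat) : (2 <= N)%nat ->
  Permutation (S_list N Ns) (alpha_quads N Ns).
Proof.
  intros HN. apply NoDup_Permutation.
  - apply NoDup_filter, NoDup_all_quads.
  - apply NoDup_alpha_quads.
  - intros [[[i j] k] l]. symmetry. now apply In_alpha_quads.
Qed.

(** * The number of nodes is the genus *)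

Lemma list_sum_map_mul {A : Type} (x : nat) (f : A -> nat) (l : list A) :
  list_sum (map (fun k => x * f k)%nat l) = (x * list_sum (map f l))%nat.
Proof. induction l as [|y l IH]; simpl; [lia|]. rewrite IH. lia. Qed.

Lemma length_flat_map_list_sum {A B : Type} (g : A -> list B) (h : A -> list nat)
  (l : list A) :
  (forall x, length (g x) = list_sum (h x)) ->
  length (flat_map g l) = list_sum (flat_map h l).
Proof.
  intros H. induction l as [|x l IH]; simpl; [reflexivity|].
  now rewrite length_app, list_sum_app, H, IH.
Qed.

(** Let [T] be the sum of the [Ns m] with [m >= 3] and [W] the sum of the products [Ns k * Ns m]
    with [2 <= k < m]. Writing [n1], [n2] for [Ns 1], [Ns 2], the three families have
    [(n1 - 1) * (n2 - 1)], [W] and [(n1 - 1) * T] members, and the genus is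
    [n1 * (n2 + T) + W + 1 - (n1 + n2 + T)]. *)
Lemma genus_length (N : nat) (Ns : nat -> nat) : (2 <= N)%nat ->
  (forall i, (1 <= i <= N)%nat -> (1 <= Ns i)%nat) ->
  genus N Ns = length (S_list N Ns).
Proof.
  intros HN HNs.
  rewrite (Permutation_length (S_list_alpha_quads N Ns HN)).
  unfold genus, alpha_quads, range1.
  fold (list_sum (map Ns (seq 1 N))).
  fold (list_sum (flat_map (fun i => map (fun k => Ns i * Ns k)%nat (seq (S i) (N - i))) (seq 1 N))).
  assert (E2 : seq 2 (N - 1) = 2%nat :: seq 3 (N - 2)).
  { replace (N - 1)%nat with (S (N - 2)) by lia. reflexivity. }
  assert (E1 : seq 1 N = 1%nat :: seq 2 (N - 1)).
  { destruct N; [lia|]. simpl. now rewrite Nat.sub_0_r. }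
  rewrite E1.
  rewrite !length_app.
  rewrite (flat_map_constant_length (c := (Ns 2%nat - 1)%nat))
    by (intros; now rewrite length_map, length_seq).
  rewrite (length_flat_map_list_sum _
    (fun i => map (fun k => Ns i * Ns k)%nat (seq (S i) (N - i)))) by
    (intros k; rewrite length_flat_map; f_equal; apply map_ext; intros m;
     rewrite (flat_map_constant_length (c := Ns m)); rewrite ?length_seq; [reflexivity|];
     intros; now rewrite length_map, length_seq).
  rewrite (flat_map_constant_length (c := list_sum (map Ns (seq 3 (N - 2)))))
    by (intros; rewrite length_flat_map; f_equal; apply map_ext; intros;
        now rewrite length_map, length_seq).
  rewrite !length_seq.
  change (flat_map ?f (1%nat :: ?l)) with (f 1%nat ++ flat_map f l). cbv beta.
  rewrite list_sum_app, list_sum_map_mul.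
  rewrite !E2.
  cbn [map list_sum fold_right].
  pose proof (HNs 1%nat ltac:(lia)). pose proof (HNs 2%nat ltac:(lia)).
  fold (list_sum (map Ns (seq 3 (N - 2)))).
  generalize dependent (list_sum (map Ns (seq 3 (N - 2)))).
  match goal with |- context [list_sum ?x] => generalize (list_sum x) end.
  generalize dependent (Ns 1%nat). generalize dependent (Ns 2%nat).
  (* Writing the positive [n1] and [n2] as successors removes the truncation from the
     subtractions. *)
  intros n2 H2 n1 H1 T W. destruct n1 as [|n1], n2 as [|n2]; lia.
Qed.

(** * Triangularity of the limit matrix *)

Lemma ForallOrdPairs_flat_map {A B : Type} (R : B -> B -> Prop) (f : A -> list B)
  (l : list A) :
  (forall x, In x l -> ForallOrdPairs R (f x)) ->
  ForallOrdPairs (fun x x' => forall y y', In y (f x) -> In y' (f x') -> R y y') l ->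
  ForallOrdPairs R (flat_map f l).
Proof.
  induction l as [|x l IH]; intros Hf Hl; simpl; [constructor|].
  inversion Hl as [|? ? Hx Hl']; subst. rewrite Forall_forall in Hx.
  assert (Hr : ForallOrdPairs R (flat_map f l))
    by (apply IH; [intros; apply Hf; now right | exact Hl']).
  assert (Hc : forall y y', In y (f x) -> In y' (flat_map f l) -> R y y').
  { intros y y' Hy Hy'. apply in_flat_map in Hy'. destruct Hy' as [x' [Hx' Hy']].
    now apply (Hx x'). }
  assert (Hx0 : ForallOrdPairs R (f x)) by (apply Hf; now left).
  revert Hc Hx0. generalize (f x). intros m Hc Hm.
  induction m as [|y m IHm]; simpl; [exact Hr|].
  inversion Hm as [|? ? Hy Hm']; subst. constructor.
  - apply Forall_app. split; [exact Hy|]. apply Forall_forall. intros y' Hy'.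
    apply Hc; [now left | exact Hy'].
  - apply IHm; [intros; apply Hc; [now right | assumption] | exact Hm'].
Qed.

Lemma ForallOrdPairs_filter {A : Type} (R : A -> A -> Prop) (p : A -> bool) (l : list A) :
  ForallOrdPairs R l -> ForallOrdPairs R (filter p l).
Proof.
  induction 1 as [|x l Hx Hl IH]; simpl; [constructor|].
  destruct (p x); [|exact IH]. constructor; [|exact IH].
  apply Forall_forall. intros y Hy. apply filter_In in Hy. rewrite Forall_forall in Hx.
  now apply Hx.
Qed.

Lemma ForallOrdPairs_total {A : Type} (R : A -> A -> Prop) (l : list A) :
  (forall x y, In x l -> In y l -> R x y) -> ForallOrdPairs R l.
Proof.
  induction l as [|x l IH]; intros H; constructor.
  - apply Forall_forall. intros y Hy. apply H; [now left | now right].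
  - apply IH. intros; apply H; now right.
Qed.

Lemma ForallOrdPairs_seq_le (m n : nat) : ForallOrdPairs (fun x y => (x <= y)%nat) (seq m n).
Proof.
  revert m. induction n as [|n IH]; intros m; simpl; constructor; [|apply IH].
  apply Forall_forall. intros y Hy. apply in_seq in Hy. lia.
Qed.

Lemma ForallOrdPairs_imp_in {A : Type} (R R' : A -> A -> Prop) (l : list A) :
  NoDup l -> (forall x y, In x l -> In y l -> x <> y -> R x y -> R' x y) ->
  ForallOrdPairs R l -> ForallOrdPairs R' l.
Proof.
  intros Hn H Hl. induction Hl as [|x l Hx Hl IH]; [constructor|].
  inversion Hn as [|? ? Hxl Hn']; subst. rewrite Forall_forall in Hx. constructor.
  - apply Forall_forall. intros y Hy.
    apply H; [now left | now right | congruence | now apply Hx].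
  - apply IH; [exact Hn'|]. intros; apply H; try (now right); assumption.
Qed.

Definition quad_row (s : quad) : nat := match s with (i, _, _, _) => i end.

(** The index [i] runs in the outermost loop of [all_quads]. Triangularity requires no finer order
    among the nodes. *)
Lemma S_list_sorted (N : nat) (Ns : nat -> nat) :
  ForallOrdPairs (fun s s' => (quad_row s <= quad_row s')%nat) (S_list N Ns).
Proof.
  assert (K : forall i s, In s (flat_map (fun k => flat_map (fun j =>
      map (fun l => (i, j, k, l)) (range1 (Ns k))) (range1 (Ns i))) (seq (S i) (N - i))) ->
      quad_row s = i).
  { intros i. key_by_indices. }
  apply ForallOrdPairs_filter, ForallOrdPairs_flat_map.
  - intros i _. apply ForallOrdPairs_total. intros s s' Hs Hs'.
    apply K in Hs, Hs'. lia.
  - apply ForallOrdPairs_imp_in with (R := fun x y : nat => (x <= y)%nat).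
    + apply seq_NoDup.
    + intros x y _ _ _ Hxy s s' Hs Hs'. apply K in Hs, Hs'. lia.
    + apply ForallOrdPairs_seq_le.
Qed.

(** [tame_ord] is antisymmetric in the two lines, so lifting into the other line only changes signs,
    and vanishing and absolute value may be checked for a fixed order of the lines. *)
Lemma limit_entry_sign (ch : quad -> bool) (i j k l : nat) (al : symb) :
  limit_entry ch (i, j, k, l) al = tame_ord (i, j) (k, l) al \/
  limit_entry ch (i, j, k, l) al = - tame_ord (i, j) (k, l) al.
Proof.
  unfold limit_entry, other_line, chosen_line, tame_ord.
  destruct (ch (i, j, k, l)); simpl; [left | right]; ring.
Qed.

Ltac decide_ords :=
  unfold tame_ord, comp_ord; simpl;
  repeat match goal with
  | |- context [if pair_nat_eq_dec ?p ?q then _ else _] =>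
      let E := fresh in
      destruct (pair_nat_eq_dec p q) as [E|E];
      [first [injection E; clear E; intros; try (exfalso; lia); subst | clear E] |]
  end.

(** For the order [(i, j)], [(k, l)] of the lines, the value is 1 for the symbols [Rsym] and for
    [Tsym] based at [(1, 1)], and -1 for [Tsym] based at [(1, j)], where the line [(1, j)] is the
    common denominator. *)
Lemma limit_entry_matched (N : nat) (Ns : nat -> nat) (a b : nat -> C) (ch : quad -> bool)
  (s : quad) :
  In s (S_list N Ns) ->
  limit_entry ch s (matched_symb a b s) = 1 \/ limit_entry ch s (matched_symb a b s) = -1.
Proof.
  destruct s as [[[i j] k] l]. rewrite In_S_list. intros [H1 H2].
  assert (H : tame_ord (i, j) (k, l) (matched_symb a b (i, j, k, l)) = 1 \/
              tame_ord (i, j) (k, l) (matched_symb a b (i, j, k, l)) = -1).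
  { unfold matched_symb. destruct (Nat.eqb_spec i 1) as [->|Hi];
      [destruct (Nat.eqb_spec k 2) as [->|Hk]|].
    all: decide_ords; try (exfalso; congruence); first [left; lra | right; lra]. }
  destruct (limit_entry_sign ch i j k l (matched_symb a b (i, j, k, l))) as [-> | ->];
    destruct H as [-> | ->]; lra.
Qed.

(** A nonzero entry requires both lines of [s] to occur in the symbol. As [S_list] omits the nodes
    on the line [(1, 1)] and those of [(1, j)] with [(2, 1)], the only such node besides [s'] is
    [(2, 1; k', l')], for the symbol based at [(1, j')]. Its row index is 2, whereas that of [s'] is
    1, so the order excludes it. *)
Lemma limit_entry_unmatched (N : nat) (Ns : nat -> nat) (a b : nat -> C)
  (ch : quad -> bool) (s s' : quad) :
  In s (S_list N Ns) -> In s' (S_list N Ns) -> s <> s' ->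
  (quad_row s <= quad_row s')%nat -> limit_entry ch s (matched_symb a b s') = 0.
Proof.
  destruct s as [[[i j] k] l], s' as [[[i' j'] k'] l']. rewrite !In_S_list.
  intros [H1 H2] [H1' H2'] Hne Hle. simpl in Hle.
  assert (H : tame_ord (i, j) (k, l) (matched_symb a b (i', j', k', l')) = 0).
  { unfold matched_symb. destruct (Nat.eqb_spec i' 1) as [->|Hi];
      [destruct (Nat.eqb_spec k' 2) as [->|Hk]|].
    all: decide_ords; try (exfalso; congruence); lra. }
  destruct (limit_entry_sign ch i j k l (matched_symb a b (i', j', k', l'))) as [-> | ->];
    rewrite H; lra.
Qed.

Lemma det_limit_entry (N : nat) (Ns : nat -> nat) (a b : nat -> C) (ch : quad -> bool)
  (dA : quad) (dB : symb) :
  (2 <= N)%nat ->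
  let d := det (length (S_list N Ns))
    (fun u v => limit_entry ch (nth u (S_list N Ns) dA) (nth v (alpha_list N Ns a b) dB)) in
  d = 1 \/ d = -1.
Proof.
  intros HN. apply (det_unit_matching dA dB (limit_entry ch) (matched_symb a b)).
  - rewrite alpha_list_map. now apply Permutation_map, S_list_alpha_quads.
  - intros s Hs. now apply (limit_entry_matched N Ns).
  - apply ForallOrdPairs_imp_in with (3 := S_list_sorted N Ns).
    + apply NoDup_filter, NoDup_all_quads.
    + intros. now apply (limit_entry_unmatched N Ns).
Qed.

(** * The limit of a single pairing *)

(** Without integrability of [f] the identity persists: for [z <> 0] both integrals take the default
    value 0, and for [z = 0] both sides vanish. Hence it may be used at every [t], not only at small
    ones. *)
Lemma RInt_scal_r (f : R -> R) (x y z : R) :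
  Defs.RInt (fun th => f th * z) x y = Defs.RInt f x y * z.
Proof.
  assert (K : forall (g : R -> R) v w, is_RInt g x y v -> is_RInt (fun th => g th * w) x y (v * w)).
  { intros g v w H. rewrite Rmult_comm. apply is_RInt_ext with (fun th => w * g th).
    - intros. apply Rmult_comm.
    - exact (is_RInt_scal (V := R_NormedModule) _ _ _ w _ H). }
  destruct (excluded_middle_informative (ex_RInt f x y)) as [[v Hv]|Hn].
  - rewrite (RInt_is_RInt _ _ _ _ Hv). apply RInt_is_RInt, K, Hv.
  - assert (E : forall g, ~ ex_RInt g x y -> Defs.RInt g x y = 0).
    { intros g Hg. unfold Defs.RInt.
      destruct (excluded_middle_informative (inhabited (Riemann_integrable g x y))) as [i|n];
        [|reflexivity]. elim Hg. destruct i as [i]. now apply ex_RInt_Reals_1. }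
    rewrite (E f Hn). destruct (Req_dec z 0) as [->|Hz].
    + rewrite Rmult_0_r. apply RInt_is_RInt.
      apply is_RInt_ext with (fun _ => 0); [intros; symmetry; apply Rmult_0_r|].
      apply is_RInt_zero.
    + rewrite E; [ring|]. intros [v Hv]. apply Hn. exists (v * / z).
      apply is_RInt_ext with (fun th => f th * z * / z); [intros w _; change (f w * z * / z = f w); field; exact Hz|].
      now apply K.
Qed.

Lemma is_RInt_Im_sumC {A : Type} (l : list A) (g : A -> R -> C) (v : A -> R) (x y : R) :
  (forall q, In q l -> is_RInt (fun th => Im (g q th)) x y (v q)) ->
  is_RInt (fun th => Im (sumC l (fun q => g q th))) x y
    (fold_right (fun q acc => v q + acc) 0 l).
Proof.
  induction l as [|q l IH]; intros H; simpl.
  - apply is_RInt_zero.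
  - apply (is_RInt_plus (V := R_NormedModule) (fun th => Im (g q th))
             (fun th => Im (sumC l (fun q => g q th)))).
    + apply H. now left.
    + apply IH. intros. apply H. now right.
Qed.

Lemma sum_indicator (l : list (nat * nat)) (q0 : nat * nat) (z : R) :
  NoDup l -> In q0 l ->
  fold_right (fun q acc => (if pair_nat_eq_dec q q0 then z else 0) + acc) 0 l = z.
Proof.
  assert (K : forall l, ~ In q0 l ->
    fold_right (fun q acc => (if pair_nat_eq_dec q q0 then z else 0) + acc) 0 l = 0).
  { induction l0 as [|q m IH]; simpl; intros H; [reflexivity|].
    destruct (pair_nat_eq_dec q q0); [tauto|]. rewrite IH by tauto. ring. }
  induction 1 as [|q l Hq Hl IH]; simpl; [tauto|]. intros [->|H].
  - destruct (pair_nat_eq_dec q0 q0); [|congruence]. rewrite K by exact Hq. ring.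
  - destruct (pair_nat_eq_dec q q0); [congruence|]. rewrite IH by exact H. ring.
Qed.

Lemma prodC_middle {A : Type} (l1 l2 : list A) (x : A) (f : A -> C) :
  prodC (l1 ++ x :: l2) f = (f x * prodC (l1 ++ l2) f)%C.
Proof. induction l1 as [|y l1 IH]; simpl; [reflexivity|]. rewrite IH. ring. Qed.

Lemma prodC_ext {A : Type} (l : list A) (f g : A -> C) :
  (forall q, f q = g q) -> prodC l f = prodC l g.
Proof. intros H. induction l as [|q l IH]; simpl; [reflexivity|]. now rewrite H, IH. Qed.

Lemma In_line_indices (N : nat) (Ns : nat -> nat) (p : nat * nat) :
  In p (line_indices N Ns) <-> valid_line N Ns p.
Proof.
  destruct p as [i j]. unfold line_indices, valid_line, range1. rewrite in_flat_map. split.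
  - intros [i' [Hi H]]. apply in_map_iff in H. destruct H as [j' [[= <- <-] Hj]].
    rewrite in_seq in *. simpl. lia.
  - simpl. intros H. exists i. split; [apply in_seq; lia|]. apply in_map_iff. exists j.
    split; [reflexivity | apply in_seq; lia].
Qed.

Lemma NoDup_line_indices (N : nat) (Ns : nat -> nat) : NoDup (line_indices N Ns).
Proof.
  unfold line_indices. apply (NoDup_flat_map_key fst); [|apply seq_NoDup].
  intros i _. split.
  - apply NoDup_map_seq. now intros x y [=].
  - intros p H. apply in_map_iff in H. now destruct H as [j [<- _]].
Qed.

(** * Restriction of the lines to the chosen one, and the loop at a single node *)

Definition line_val (a b : nat -> C) (c : nat -> nat -> C) (q : nat * nat) (P : C * C) : C :=
  Lval a b c (fst q) (snd q) P.

(* Derivative of [line_val q] along the line [p], parametrised by [x]. *)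
Definition slope (a b : nat -> C) (p q : nat * nat) : C :=
  (a (fst q) - b (fst q) * a (fst p) / b (fst p))%C.

(** Eliminating [y] in favour of the value of the line [p] produces the coefficients [e], [kap] and
    [bet] of the section [ChosenBranch]. *)
Lemma line_val_along (a b : nat -> C) (c : nat -> nat -> C) (p q : nat * nat) (x h y : C) :
  b (fst p) <> 0%C ->
  line_val a b c q ((x + h)%C, y) =
  (line_val a b c q (x, lift_y a b c p x) + slope a b p q * h
   + b (fst q) / b (fst p) * line_val a b c p ((x + h)%C, y))%C.
Proof.
  intros Hb. unfold line_val, slope.
  change (a (fst q) * (x + h) + b (fst q) * y + c (fst q) (snd q) =
    a (fst q) * x + b (fst q) * (- ((a (fst p) * x + c (fst p) (snd p)) / b (fst p)))
      + c (fst q) (snd q)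
    + (a (fst q) - b (fst q) * a (fst p) / b (fst p)) * h
    + b (fst q) / b (fst p) * (a (fst p) * (x + h) + b (fst p) * y + c (fst p) (snd p)))%C.
  field. exact Hb.
Qed.

Lemma Lder_along (a b : nat -> C) (p q : nat * nat) (dx dy : C) :
  b (fst p) <> 0%C ->
  Lder a b (fst q) (dx, dy) =
  (slope a b p q * dx + b (fst q) / b (fst p) * Lder a b (fst p) (dx, dy))%C.
Proof.
  intros Hb. unfold slope.
  change (a (fst q) * dx + b (fst q) * dy =
    (a (fst q) - b (fst q) * a (fst p) / b (fst p)) * dx
    + b (fst q) / b (fst p) * (a (fst p) * dx + b (fst p) * dy))%C.
  field. exact Hb.
Qed.

Lemma line_val_lift (a b : nat -> C) (c : nat -> nat -> C) (p : nat * nat) (x y : C) :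
  b (fst p) <> 0%C ->
  line_val a b c p (x, y) = (b (fst p) * (y - lift_y a b c p x))%C.
Proof.
  intros Hb. unfold line_val.
  change (a (fst p) * x + b (fst p) * y + c (fst p) (snd p) =
    b (fst p) * (y - - ((a (fst p) * x + c (fst p) (snd p)) / b (fst p))))%C.
  field. exact Hb.
Qed.

Lemma Fpoly_prodC (N : nat) (Ns : nat -> nat) (a b : nat -> C) (c : nat -> nat -> C) (P : C * C) :
  Fpoly N Ns a b c P = prodC (line_indices N Ns) (fun q => line_val a b c q P).
Proof. reflexivity. Qed.

Section Node.
Variables (N : nat) (Ns : nat -> nat) (a b : nat -> C) (c : nat -> nat -> C).
Variables (p q0 : nat * nat) (xs : C) (r : R) (Y DY : C -> R -> C).
Hypothesis r_pos : 0 < r.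
Hypothesis b_neq0 : b (fst p) <> 0%C.
Hypothesis p_valid : valid_line N Ns p.
Hypothesis q0_valid : valid_line N Ns q0.
Hypothesis q0_neq : q0 <> p.
Hypothesis q0_meets : line_val a b c q0 (xs, lift_y a b c p xs) = 0%C.
Hypothesis q0_slope : slope a b p q0 <> 0%C.
Hypothesis far_lines : forall q, valid_line N Ns q -> q <> p -> q <> q0 ->
  Cmod (slope a b p q) * r < Cmod (line_val a b c q (xs, lift_y a b c p xs)).

Let X (th : R) : C := (xs + circ r th)%C.
Let P (t : C) (th : R) : C * C := (X th, Y t th).
Let DP (t : C) (th : R) : C * C := (dcirc r th, DY t th).

Hypothesis on_curve : for_small_t (fun t th => Fpoly N Ns a b c (P t th) = t).
Hypothesis Y_deriv : for_small_t (fun t th => cderiv (Y t) th (DY t th)).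
Hypothesis Y_lim : forall eps, 0 < eps ->
  for_small_t (fun t th => Cmod (Y t th - lift_y a b c p (X th)) < eps).

Let e (q : nat * nat) : C := line_val a b c q (xs, lift_y a b c p xs).
Let kap (q : nat * nat) : C := slope a b p q.
Let bet (q : nat * nat) : C := (b (fst q) / b (fst p))%C.
Let u (t : C) (th : R) : C := line_val a b c p (P t th).
Let du (t : C) (th : R) : C := Lder a b (fst p) (DP t th).
Let dlog (q : nat * nat) (th : R) : C :=
  (kap q * dcirc r th / (e q + kap q * circ r th))%C.

Lemma node_lines : exists l : list (nat * nat),
  NoDup l /\ (forall q, In q l <-> valid_line N Ns q /\ q <> p) /\
  forall f, prodC (line_indices N Ns) f = (f p * prodC l f)%C.
Proof.
  destruct (in_split p (line_indices N Ns)) as [l1 [l2 E]]; [now apply In_line_indices|].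
  pose proof (NoDup_line_indices N Ns) as Hnd. rewrite E in Hnd.
  exists (l1 ++ l2). apply NoDup_remove in Hnd. destruct Hnd as [H1 H2].
  split; [exact H1|]. split.
  - intros q. rewrite <- In_line_indices, E, !in_app_iff. simpl. split.
    + intros H. split; [tauto|]. intros ->. apply H2, in_or_app, H.
    + intros [[H|[H|H]] Hne]; [tauto|congruence|tauto].
  - intros f. rewrite E. apply prodC_middle.
Qed.

Lemma node_u_lim (eps : R) : 0 < eps -> for_small_t (fun t th => Cmod (u t th) < eps).
Proof.
  intros Heps. assert (Hb : 0 < Cmod (b (fst p))) by now apply Cmod_gt_0.
  apply for_small_t_imp with (2 := Y_lim (eps / Cmod (b (fst p))) (Rdiv_lt_0_compat _ _ Heps Hb)).
  intros t th _ _ H. unfold u, P. rewrite line_val_lift by exact b_neq0. rewrite Cmod_mult.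
  apply (Rmult_lt_compat_l _ _ _ Hb) in H.
  now replace (Cmod (b (fst p)) * (eps / Cmod (b (fst p)))) with eps in H by (field; lra).
Qed.

Lemma node_u_deriv : for_small_t (fun t th => cderiv (u t) th (du t th)).
Proof.
  apply for_small_t_imp with (2 := Y_deriv). intros t th _ _ H. unfold u, du, P, DP.
  change (cderiv (fun th => a (fst p) * (xs + circ r th) + b (fst p) * Y t th
                            + c (fst p) (snd p))%C th
                 (a (fst p) * dcirc r th + b (fst p) * DY t th)%C).
  eapply cderiv_eq;
    [|exact (cderiv_plus _ _ _ _ _ (cderiv_plus _ _ _ _ _
        (cderiv_scal (a (fst p)) _ _ _
           (cderiv_plus _ _ _ _ _ (cderiv_const xs th) (cderiv_circ r th)))
        (cderiv_scal (b (fst p)) _ _ _ H)) (cderiv_const (c (fst p) (snd p)) th))].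
  ring.
Qed.

Lemma node_u_prod (l : list (nat * nat)) :
  (forall f, prodC (line_indices N Ns) f = (f p * prodC l f)%C) ->
  for_small_t (fun t th =>
    (u t th * prodC l (fun q => e q + kap q * circ r th + bet q * u t th))%C = t).
Proof.
  intros Hl. apply for_small_t_imp with (2 := on_curve). intros t th _ _ H.
  rewrite Fpoly_prodC, Hl in H. rewrite <- H at 2. unfold u. f_equal.
  apply prodC_ext. intros q. symmetry. now apply line_val_along.
Qed.

(** Along [p], the line [q0] vanishes only at the centre of the circle, and [far_lines] keeps the
    other lines from vanishing anywhere in the closed disc. *)
Lemma node_ell_lower (q : nat * nat) : valid_line N Ns q -> q <> p ->
  exists m, 0 < m /\
    forall th, 0 <= th <= 2 * PI -> m <= Cmod (e q + kap q * circ r th).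
Proof.
  intros Hq Hne. destruct (pair_nat_eq_dec q q0) as [->|Hq0].
  - exists (Cmod (kap q0) * r). split.
    + apply Rmult_lt_0_compat; [now apply Cmod_gt_0 | exact r_pos].
    + intros th _. unfold e. rewrite q0_meets, Cplus_0_l, Cmod_mult, Cmod_circ; lra.
  - exists (Cmod (e q) - Cmod (kap q) * r). pose proof (far_lines q Hq Hne Hq0) as H.
    split; [unfold e, kap; lra|]. intros th _.
    pose proof (Cmod_triangle (e q + kap q * circ r th) (- (kap q * circ r th))) as T.
    replace (e q + kap q * circ r th + - (kap q * circ r th))%C with (e q) in T by ring.
    rewrite Cmod_opp, Cmod_mult, Cmod_circ in T by exact r_pos. lra.
Qed.

Lemma node_dlog_integral (q : nat * nat) : valid_line N Ns q -> q <> p ->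
  is_RInt (fun th => Im (dlog q th)) 0 (2 * PI) (if pair_nat_eq_dec q q0 then 2 * PI else 0).
Proof.
  intros Hq Hne. unfold dlog. destruct (pair_nat_eq_dec q q0) as [->|Hq0].
  - unfold e. rewrite q0_meets. now apply is_RInt_log_deriv_node.
  - now apply is_RInt_log_deriv_far, far_lines.
Qed.

(** The limiting winding number of the line along the loop. It is -1 for [p] because the product of
    all lines is the constant [t], so the winding numbers add up to 0. *)
Definition node_weight (q : nat * nat) : R :=
  (if pair_nat_eq_dec q q0 then 1 else 0) - (if pair_nat_eq_dec q p then 1 else 0).

Lemma node_line_limits : exists dl : nat * nat -> R -> C,
  forall q, valid_line N Ns q ->
    ulim (fun t th => Complex.RtoC (ln (Cmod (line_val a b c q (P t th))) / ln (Cmod t)))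
         (fun _ => Complex.RtoC (if pair_nat_eq_dec q p then 1 else 0)) /\
    ulim (fun t th => Lder a b (fst q) (DP t th) / line_val a b c q (P t th))%C (dl q) /\
    is_RInt (fun th => Im (dl q th)) 0 (2 * PI) (2 * PI * node_weight q).
Proof.
  destruct node_lines as [l [Hnd [Hl Hprod]]].
  assert (Hlow : forall q, In q l -> exists m, 0 < m /\
     forall th, 0 <= th <= 2 * PI -> m <= Cmod (e q + kap q * circ r th))
    by (intros q Hq; apply Hl in Hq; now apply node_ell_lower).
  exists (fun q th => if pair_nat_eq_dec q p then (- sumC l (fun q => dlog q th))%C else dlog q th).
  intros q Hq. unfold node_weight. destruct (pair_nat_eq_dec q p) as [->|Hne].
  - split; [|split].
    + exact (branch_ln_u_ulim _ l e kap bet r u du r_pos node_u_lim node_u_deriv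
               (node_u_prod l Hprod) Hlow).
    + exact (branch_log_deriv_u_ulim _ l e kap bet r u du r_pos node_u_lim node_u_deriv
               (node_u_prod l Hprod) Hlow).
    + destruct (pair_nat_eq_dec p q0) as [E|_]; [congruence|].
      replace (2 * PI * (0 - 1)) with (- (2 * PI)) by ring.
      (* The total [2 * PI] is spread over all lines of [l], with [q0] carrying all of it, to match
         the sum of logarithmic derivatives term by term. *)
      rewrite <- (sum_indicator l q0 (2 * PI) Hnd) at 2 by (apply Hl; now split).
      apply (is_RInt_opp (V := R_NormedModule) (fun th => Im (sumC l (fun q => dlog q th)))).
      apply is_RInt_Im_sumC. intros q Hq'. apply Hl in Hq'. now apply node_dlog_integral.
  - assert (Hql : In q l) by now apply Hl.
    split; [|split].
    + eapply ulim_ext; [|reflexivity|exact (branch_ln_L_ulim _ l e kap bet r u du r_pos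
        node_u_lim node_u_deriv Hlow q Hql)].
      apply for_small_t_always. intros t th. cbv beta.
      unfold P, X. now rewrite (line_val_along a b c p q).
    + eapply ulim_ext; [|reflexivity|exact (branch_log_deriv_L_ulim _ l e kap bet r u du r_pos
        node_u_lim node_u_deriv (node_u_prod l Hprod) Hlow q Hql)].
      apply for_small_t_always. intros t th. cbv beta.
      unfold P, X, DP. now rewrite (line_val_along a b c p q), (Lder_along a b p q).
    + replace (2 * PI * ((if pair_nat_eq_dec q q0 then 1 else 0) - 0))
        with (if pair_nat_eq_dec q q0 then 2 * PI else 0)
        by (destruct (pair_nat_eq_dec q q0); ring).
      now apply node_dlog_integral.
Qed.

Definition comp_valid (A : comp) : Prop :=
  match A with (_, num, den) => valid_line N Ns num /\ valid_line N Ns den end.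

Lemma node_comp_limits (A : comp) : comp_valid A -> exists g : R -> R,
  ulim (fun t th => Complex.RtoC (comp_logabs a b c A (P t th) / ln (Cmod t)))
       (fun _ => Complex.RtoC (comp_ord p A)) /\
  ulim (fun t th => Complex.RtoC (comp_darg a b c A (P t th) (DP t th)))
       (fun th => Complex.RtoC (g th)) /\
  is_RInt g 0 (2 * PI) (2 * PI * (comp_ord q0 A - comp_ord p A)).
Proof.
  destruct A as [[z [n1 n2]] [d1 d2]]. simpl. intros [Hn Hd].
  destruct node_line_limits as [dl Hdl].
  destruct (Hdl _ Hn) as [N1 [N2 N3]], (Hdl _ Hd) as [D1 [D2 D3]].
  exists (fun th => Im (dl (n1, n2) th) - Im (dl (d1, d2) th)). split; [|split].
  - eapply ulim_ext; [| |exact (ulim_plus _ _ _ _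
      (ulim_plus _ _ _ _
         (ulim_mult _ _ _ _ (ulim_const (Complex.RtoC (ln (Cmod z)))) ulim_inv_ln) N1)
      (ulim_mult _ _ _ _ (ulim_const (Complex.RtoC (-1))) D1))].
    + apply for_small_t_always. intros t th. cbv beta.
      rewrite <- !RtoC_mult, <- !RtoC_plus. f_equal.
      unfold line_val, Rdiv. simpl. change Cnorm with Cmod. ring.
    + intros th _. cbv beta.
      rewrite <- !RtoC_mult, <- !RtoC_plus. f_equal.
      destruct (pair_nat_eq_dec (n1, n2) p), (pair_nat_eq_dec p (n1, n2)),
        (pair_nat_eq_dec (d1, d2) p), (pair_nat_eq_dec p (d1, d2)); try congruence; ring.
  - eapply ulim_ext; [| |exact (ulim_plus _ _ _ _ (ulim_Im _ _ N2)
      (ulim_mult _ _ _ _ (ulim_const (Complex.RtoC (-1))) (ulim_Im _ _ D2)))].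
    + apply for_small_t_always. intros t th. cbv beta.
      rewrite <- !RtoC_mult, <- !RtoC_plus. f_equal.
      match goal with |- ?x + -1 * ?y = _ => transitivity (x - y); [ring | reflexivity] end.
    + intros th _. cbv beta. rewrite <- !RtoC_mult, <- !RtoC_plus. f_equal. ring.
  - pose proof (is_RInt_minus (V := R_NormedModule) _ _ _ _ _ _ N3 D3) as M.
    replace (2 * PI * _) with (2 * PI * node_weight (n1, n2) - 2 * PI * node_weight (d1, d2)).
    + exact M.
    + unfold node_weight.
      destruct (pair_nat_eq_dec (n1, n2) p), (pair_nat_eq_dec p (n1, n2)),
        (pair_nat_eq_dec (d1, d2) p), (pair_nat_eq_dec p (d1, d2)),
        (pair_nat_eq_dec (n1, n2) q0), (pair_nat_eq_dec q0 (n1, n2)),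
        (pair_nat_eq_dec (d1, d2) q0), (pair_nat_eq_dec q0 (d1, d2));
        try congruence; ring.
Qed.

Lemma node_pairing_tends (al : symb) : comp_valid (fst al) -> comp_valid (snd al) ->
  tends (fun t => pairing a b c (P t) (DP t) al * / ln (Cmod t)) (tame_ord p q0 al).
Proof.
  intros HA HB.
  destruct (node_comp_limits _ HA) as [gA [A1 [A2 A3]]], (node_comp_limits _ HB) as [gB [B1 [B2 B3]]].
  set (oA := comp_ord p (fst al)) in *. set (oB := comp_ord p (snd al)) in *.
  (* The factor [/ ln (Cmod t)] is constant along the loop; it is placed under the integral because
     only the scaled integrand converges uniformly. *)
  assert (K : tends (fun t => Defs.RInt (fun th =>
       eta_pullback a b c al (P t th) (DP t th) * / ln (Cmod t)) 0 (2 * PI))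
     (2 * PI * tame_ord p q0 al)).
  { apply ulim_RInt with (fun th => oA * gB th - oB * gA th).
    - eapply ulim_ext; [| |exact (ulim_plus _ _ _ _ (ulim_mult _ _ _ _ A1 B2)
        (ulim_mult _ _ _ _ (ulim_const (Complex.RtoC (-1))) (ulim_mult _ _ _ _ B1 A2)))].
      + apply for_small_t_always. intros t th. cbv beta.
        rewrite <- !RtoC_mult, <- !RtoC_plus. f_equal.
        unfold eta_pullback, Rdiv. ring.
      + intros th _. cbv beta. rewrite <- !RtoC_mult, <- !RtoC_plus. f_equal. ring.
    (* The two products [oA * oB], which come from the winding number -1 of the line [p], cancel. *)
    - replace (2 * PI * tame_ord p q0 al)
        with (oA * (2 * PI * (comp_ord q0 (snd al) - oB))
              - oB * (2 * PI * (comp_ord q0 (fst al) - oA)))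
        by (unfold tame_ord, oA, oB; ring).
      exact (is_RInt_minus (V := R_NormedModule) _ _ _ _ _ _
               (is_RInt_scal (V := R_NormedModule) _ _ _ oA _ B3)
               (is_RInt_scal (V := R_NormedModule) _ _ _ oB _ A3)). }
  pose proof PI_RGT_0.
  apply (tends_mult _ _ _ _ (tends_const (/ (2 * PI)))) in K.
  replace (/ (2 * PI) * (2 * PI * tame_ord p q0 al)) with (tame_ord p q0 al) in K by (field; lra).
  revert K. apply tends_ext. intros t. rewrite RInt_scal_r. unfold pairing. ring.
Qed.

End Node.

(** * Choice of the radius *)

Lemma small_radius_list {A : Type} (l : list A) (Q : A -> R -> Prop) :
  (forall x, In x l -> exists r0, 0 < r0 /\ forall r, 0 < r < r0 -> Q x r) ->
  exists r0, 0 < r0 /\ forall r, 0 < r < r0 -> forall x, In x l -> Q x r.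
Proof.
  induction l as [|x l IH]; intros H.
  - exists 1. split; [lra|]. intros r _ x [].
  - destruct (H x (or_introl eq_refl)) as [r1 [Hr1 H1]].
    destruct IH as [r2 [Hr2 H2]]; [intros; apply H; now right|].
    exists (Rmin r1 r2). split; [now apply Rmin_pos|]. intros r Hr y Hy.
    pose proof (Rmin_l r1 r2). pose proof (Rmin_r r1 r2).
    destruct Hy as [<-|Hy]; [apply H1 | apply H2; [|exact Hy]]; lra.
Qed.

Lemma intersection_on_lines (a b : nat -> C) (c : nat -> nat -> C) (i j k l : nat) :
  bracket a b i k <> C0 ->
  line_val a b c (i, j) (Px a b c i j k l, Py a b c i j k l) = 0%C /\
  line_val a b c (k, l) (Px a b c i j k l, Py a b c i j k l) = 0%C.
Proof.
  intros H. change ((a i * b k - a k * b i)%C <> 0%C) in H. split.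
  - change (a i * ((- (c i j * b k) + c k l * b i) / (a i * b k - a k * b i))
      + b i * ((- (a i * c k l) + a k * c i j) / (a i * b k - a k * b i)) + c i j = 0)%C.
    field. exact H.
  - change (a k * ((- (c i j * b k) + c k l * b i) / (a i * b k - a k * b i))
      + b k * ((- (a i * c k l) + a k * c i j) / (a i * b k - a k * b i)) + c k l = 0)%C.
    field. exact H.
Qed.

Lemma lift_y_on_line (a b : nat -> C) (c : nat -> nat -> C) (p : nat * nat) (x y : C) :
  b (fst p) <> 0%C -> line_val a b c p (x, y) = 0%C -> lift_y a b c p x = y.
Proof.
  intros Hb H. rewrite line_val_lift in H by exact Hb.
  revert H. generalize (lift_y a b c p x) as z. intros z H.
  assert (E : (y - / b (fst p) * (b (fst p) * (y - z)))%C = z) by (field; exact Hb).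
  rewrite H in E. rewrite <- E. change ((y - / b (fst p) * 0)%C = y). ring.
Qed.

(** Up to the factor [b (fst p)] the slope is the bracket. *)
Lemma slope_neq0 (a b : nat -> C) (p q : nat * nat) :
  b (fst p) <> 0%C -> bracket a b (fst q) (fst p) <> C0 -> slope a b p q <> 0%C.
Proof.
  intros Hb H E. apply H.
  change ((a (fst q) * b (fst p) - a (fst p) * b (fst q))%C = 0%C).
  transitivity (b (fst p) * slope a b p q)%C.
  - unfold slope. field. exact Hb.
  - rewrite E. ring.
Qed.

Definition node_config (N : nat) (Ns : nat -> nat) (a b : nat -> C) (c : nat -> nat -> C)
  (p q0 : nat * nat) (xs : C) : Prop :=
  valid_line N Ns p /\ valid_line N Ns q0 /\ fst q0 <> fst p /\
  line_val a b c q0 (xs, lift_y a b c p xs) = 0%C /\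
  forall q, valid_line N Ns q -> q <> p -> q <> q0 ->
    line_val a b c q (xs, lift_y a b c p xs) <> 0%C.

Lemma quad_node_config (N : nat) (Ns : nat -> nat) (a b : nat -> C) (c : nat -> nat -> C)
  (ch : quad -> bool) (s : quad) :
  (forall i k, (1 <= i <= N)%nat -> (1 <= k <= N)%nat -> i <> k -> bracket a b i k <> C0) ->
  (forall p q u : nat * nat,
     valid_line N Ns p -> valid_line N Ns q -> valid_line N Ns u ->
     p <> q -> p <> u -> q <> u ->
     ~ exists P : C * C, line_val a b c p P = 0%C /\ line_val a b c q P = 0%C /\
                         line_val a b c u P = 0%C) ->
  (forall i, (1 <= i <= N)%nat -> b i <> C0) ->
  In s (S_list N Ns) ->
  node_config N Ns a b c (chosen_line ch s) (other_line ch s) (quad_x a b c s).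
Proof.
  intros Hbr Hno3 Hb. destruct s as [[[i j] k] l]. rewrite In_S_list. intros [H _].
  assert (V1 : valid_line N Ns (i, j)) by (unfold valid_line; simpl; lia).
  assert (V2 : valid_line N Ns (k, l)) by (unfold valid_line; simpl; lia).
  destruct (intersection_on_lines a b c i j k l) as [E1 E2]; [apply Hbr; lia|].
  assert (Hne : (i, j) <> (k, l)) by (intros [=]; lia).
  assert (B1 : b i <> C0) by (apply Hb; lia). assert (B2 : b k <> C0) by (apply Hb; lia).
  pose proof (lift_y_on_line a b c (i, j) _ _ B1 E1) as Y1.
  pose proof (lift_y_on_line a b c (k, l) _ _ B2 E2) as Y2.
  unfold node_config, other_line, chosen_line, quad_x.
  destruct (ch (i, j, k, l)); simpl negb; cbv iota; rewrite ?Y1, ?Y2.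
  - repeat split; try apply V1; try apply V2; [simpl; lia | exact E2 |].
    intros q Vq Q1 Q2 Eq. apply (Hno3 (i, j) (k, l) q); auto. eauto.
  - repeat split; try apply V1; try apply V2; [simpl; lia | exact E1 |].
    intros q Vq Q1 Q2 Eq. apply (Hno3 (i, j) (k, l) q); auto. eauto.
Qed.

Lemma chosen_line_const (ch : quad -> bool) (s : quad) :
  chosen_line (fun _ => ch s) s = chosen_line ch s /\
  other_line (fun _ => ch s) s = other_line ch s.
Proof. now destruct s as [[[i j] k] l]. Qed.

(** The radius has to be fixed before [ch]. At a node only the boolean [ch s] matters, so the
    conditions are indexed by the finitely many triples of a node, a boolean and a line. *)
Lemma separating_radius (N : nat) (Ns : nat -> nat) (a b : nat -> C) (c : nat -> nat -> C) :
  (forall ch s, In s (S_list N Ns) ->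
     node_config N Ns a b c (chosen_line ch s) (other_line ch s) (quad_x a b c s)) ->
  exists r0, 0 < r0 /\ forall r, 0 < r < r0 -> forall ch s, In s (S_list N Ns) ->
    forall q, valid_line N Ns q -> q <> chosen_line ch s -> q <> other_line ch s ->
      Cmod (slope a b (chosen_line ch s) q) * r <
      Cmod (line_val a b c q
              (quad_x a b c s, lift_y a b c (chosen_line ch s) (quad_x a b c s))).
Proof.
  intros Hcfg.
  pose (Q := fun (s : quad) (be : bool) (q : nat * nat) (r : R) =>
    q <> chosen_line (fun _ => be) s -> q <> other_line (fun _ => be) s ->
    Cmod (slope a b (chosen_line (fun _ => be) s) q) * r <
    Cmod (line_val a b c q (quad_x a b c s,
            lift_y a b c (chosen_line (fun _ => be) s) (quad_x a b c s)))).
  destruct (small_radius_list (S_list N Ns) (fun s r => forall be, In be [true; false] ->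
    forall q, In q (line_indices N Ns) -> Q s be q r)) as [r0 [Hr0 H]].
  - intros s Hs. apply small_radius_list. intros be _. apply small_radius_list.
    intros q Hq. apply In_line_indices in Hq.
    destruct (Hcfg (fun _ => be) s Hs) as [_ [_ [_ [_ Hfar]]]].
    destruct (pair_nat_eq_dec q (chosen_line (fun _ => be) s)) as [E|Q1];
      [exists 1; split; [lra|]; now intros r _ K|].
    destruct (pair_nat_eq_dec q (other_line (fun _ => be) s)) as [E|Q2];
      [exists 1; split; [lra|]; now intros r _ _ K|].
    specialize (Hfar q Hq Q1 Q2). apply Cmod_gt_0 in Hfar.
    set (K := Cmod (slope a b (chosen_line (fun _ => be) s) q)).
    assert (0 <= K) by apply Cmod_ge_0.
    set (M := Cmod (line_val a b c q (quad_x a b c s,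
            lift_y a b c (chosen_line (fun _ => be) s) (quad_x a b c s)))).
    assert (HM : 0 < M) by exact Hfar.
    (* The slope [K] is 0 for lines parallel to the chosen one, hence the added 1. *)
    exists (M / (K + 1)). split; [apply Rdiv_lt_0_compat; lra|].
    intros r [Hr1 Hr2] _ _. change (K * r < M).
    apply Rmult_lt_compat_r with (r := K + 1) in Hr2; [|lra].
    unfold Rdiv in Hr2. rewrite Rmult_assoc, Rinv_l, Rmult_1_r in Hr2; lra.
  - exists r0. split; [exact Hr0|]. intros r Hr ch s Hs q Hq.
    destruct (chosen_line_const ch s) as [<- <-].
    apply H; [exact Hr | exact Hs | destruct (ch s); simpl; tauto | now apply In_line_indices].
Qed.

Lemma In_alpha_list_valid (N : nat) (Ns : nat -> nat) (a b : nat -> C) (al : symb) :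
  (2 <= N)%nat -> (forall i, (1 <= i <= N)%nat -> (1 <= Ns i)%nat) ->
  In al (alpha_list N Ns a b) -> comp_valid N Ns (fst al) /\ comp_valid N Ns (snd al).
Proof.
  intros HN HNs. rewrite alpha_list_map. intros H. apply in_map_iff in H.
  destruct H as [[[[i j] k] l] [<- H]]. apply In_alpha_quads, In_S_list in H; [|exact HN].
  pose proof (HNs 1%nat ltac:(lia)). pose proof (HNs 2%nat ltac:(lia)).
  unfold matched_symb. destruct (Nat.eqb_spec i 1) as [->|Hi];
    [destruct (Nat.eqb_spec k 2) as [->|Hk]|];
    unfold valid_line; simpl; unfold valid_line; simpl; repeat split; lia.
Qed.

Theorem theorem6p4
  (N : nat) (Ns : nat -> nat) (a b : nat -> CC) (c : nat -> nat -> CC)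
  (* N >= 2, N_i >= 1 *)
  (HN : (2 <= N)%nat)
  (HNs : forall i, (1 <= i <= N)%nat -> (1 <= Ns i)%nat)
  (* the L_{i,j} are non-constant *)
  (Hnc : forall i, (1 <= i <= N)%nat -> a i <> C0 \/ b i <> C0)
  (* [i,k] <> 0 for i <> k *)
  (Hbr : forall i k, (1 <= i <= N)%nat -> (1 <= k <= N)%nat -> i <> k ->
           bracket a b i k <> C0)
  (* the lines are pairwise distinct *)
  (Hdist : forall i j k, (1 <= i <= N)%nat -> (1 <= j <= Ns i)%nat ->
           (1 <= k <= Ns i)%nat -> j <> k -> c i j <> c i k)
  (* no three of the lines meet in an affine point *)
  (Hno3 : forall p q u : nat * nat,
           valid_line N Ns p -> valid_line N Ns q -> valid_line N Ns u ->
           p <> q -> p <> u -> q <> u ->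
           ~ exists P : CC * CC,
               Lval a b c (fst p) (snd p) P = C0 /\
               Lval a b c (fst q) (snd q) P = C0 /\
               Lval a b c (fst u) (snd u) P = C0)
  (* choice of coordinates: the x-projection of X_0 is unramified (no vertical line) *)
  (Hcoord1 : forall i, (1 <= i <= N)%nat -> b i <> C0)
  (* distinct intersection points have distinct x-coordinates *)
  (Hcoord2 : forall i j k l i' j' k' l' : nat,
      In (i, j, k, l) (all_quads N Ns) -> In (i', j', k', l') (all_quads N Ns) ->
      (Px a b c i j k l, Py a b c i j k l) <> (Px a b c i' j' k' l', Py a b c i' j' k' l') ->
      Px a b c i j k l <> Px a b c i' j' k' l') :
  exists r0 : R, 0 < r0 /\
  forall (r : R), 0 < r < r0 ->
  forall (ch : quad -> bool) (Y DY : quad -> CC -> R -> CC),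
    (* gamma_{s,t} : theta |-> (x_s + r e^{i theta}, Y s t theta) is a closed loop on
       prod L = t (for 0 < |t| small), with derivative DY in theta ... *)
    (exists d0 : R, 0 < d0 /\
       forall s, In s (S_list N Ns) ->
       forall t : CC, 0 < Cnorm t < d0 ->
         Y s t 0 = Y s t (2 * PI) /\
         forall th, 0 <= th <= 2 * PI ->
           Fpoly N Ns a b c (circ_x a b c r s th, Y s t th) = t /\
           derivable_pt_lim (fun u => Cre (Y s t u)) th (Cre (DY s t th)) /\
           derivable_pt_lim (fun u => Cim (Y s t u)) th (Cim (DY s t th))) ->
    (* ... which is the continuous deformation of the lift gamma_{s,0} of the circle
       into the chosen line L through s *)
    (forall s, In s (S_list N Ns) ->
       forall eps, 0 < eps -> exists del, 0 < del /\
         forall t : CC, 0 < Cnorm t < del ->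
         forall th, 0 <= th <= 2 * PI ->
           Cnorm (Csub (Y s t th)
                       (lift_y a b c (chosen_line ch s) (circ_x a b c r s th))) < eps) ->
    exists l : R, (l = 1 \/ l = -1) /\
      forall eps, 0 < eps -> exists del, 0 < del /\
        forall t : CC, 0 < Cnorm t < del ->
          Rabs (det (genus N Ns) (reg_matrix N Ns a b c r Y DY t)
                / (ln (Cnorm t)) ^ (genus N Ns) - l) < eps.
Proof.
  assert (Hcfg : forall ch s, In s (S_list N Ns) ->
    node_config N Ns a b c (chosen_line ch s) (other_line ch s) (quad_x a b c s))
    by (intros; now apply quad_node_config).
  destruct (separating_radius N Ns a b c Hcfg) as [r0 [Hr0 Hsep]].
  exists r0. split; [exact Hr0|]. intros r Hr ch Y DY [d0 [Hd0 Hloop]] Hlim.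
  set (dA := (0, 0, 0, 0)%nat).
  set (dB := ((C1, (0, 0), (0, 0)), (C1, (0, 0), (0, 0)))%nat : symb).
  exists (det (genus N Ns) (fun u v =>
    limit_entry ch (nth u (S_list N Ns) dA) (nth v (alpha_list N Ns a b) dB))).
  pose proof (genus_length N Ns HN HNs) as Hg.
  split; [rewrite Hg; now apply det_limit_entry|].
  assert (Halen : length (alpha_list N Ns a b) = genus N Ns).
  { rewrite Hg, alpha_list_map, length_map. symmetry.
    now apply Permutation_length, S_list_alpha_quads. }
  assert (T : tends (fun t => det (genus N Ns)
      (fun u v => reg_matrix N Ns a b c r Y DY t u v * / ln (Cmod t)))
    (det (genus N Ns) (fun u v =>
      limit_entry ch (nth u (S_list N Ns) dA) (nth v (alpha_list N Ns a b) dB)))).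
  { apply det_tends. intros u v Hu Hv. unfold reg_matrix. fold dA dB.
    assert (Hs : In (nth u (S_list N Ns) dA) (S_list N Ns)) by (apply nth_In; lia).
    assert (Hal : In (nth v (alpha_list N Ns a b) dB) (alpha_list N Ns a b))
      by (apply nth_In; lia).
    apply In_alpha_list_valid in Hal; [|assumption|assumption]. destruct Hal as [HA HB].
    revert HA HB. generalize (nth v (alpha_list N Ns a b) dB). intros al HA HB.
    revert Hs. generalize (nth u (S_list N Ns) dA). intros s Hs.
    destruct (Hcfg ch s Hs) as [V1 [V2 [Hne [Hmeet _]]]].
    assert (Hb : b (fst (chosen_line ch s)) <> C0) by (apply Hcoord1, V1).
    apply (node_pairing_tends N Ns a b c (chosen_line ch s) (other_line ch s)
             (quad_x a b c s) r (Y s) (DY s)); try assumption.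
    - lra.
    - intros E. now rewrite E in Hne.
    - apply slope_neq0; [exact Hb|]. apply Hbr; [apply V2 | apply V1 | exact Hne].
    - now apply Hsep.
    (* [Cnorm] and the complex operations of the statement are convertible with [Cmod] and those on
       [C], so the hypotheses on the loop fit as they stand. *)
    - exists d0. split; [exact Hd0|]. intros t Ht th Hth. now apply (Hloop s Hs t Ht).
    - exists d0. split; [exact Hd0|]. intros t Ht th Hth. now apply (Hloop s Hs t Ht).
    - exact (Hlim s Hs). }
  intros eps Heps. destruct (T eps Heps) as [del [Hdel K]]. exists del.
  split; [exact Hdel|]. intros t Ht. specialize (K t Ht).
  (* Scaling each of the [genus N Ns] rows by [/ ln (Cmod t)] divides the determinant by the
     required power. *)
  rewrite det_scal, pow_inv in K. exact K.
Qed.
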